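(* Let $\delta>0$, $\gamma>0$, $R>0$, $R'>0$ and $R''\geq 2$, and fix levels $\alpha$ and $\beta$ in $]0,1[$ such that $\alpha+\beta\leq 0.59$. Write $\mathcal{S}_1=\mathcal{B}_{2,\infty}^{\delta}(R)\cap W_{\gamma}(R')\cap \mathbb{L}^{\infty}(R'')$. $(i)$ If $\gamma > \max(2\delta,1/2)$, then $$\liminf_{L\to +\infty}\left(\frac{L}{\ln L}\right)^{\frac{\gamma}{1+2\gamma}}\underline{\rho}(\mathcal{S}_1,\alpha,\beta)>0 .$$ $(ii)$ If $\delta \geq \max(\gamma/2,\gamma/(1+2\gamma))$, then $$\liminf_{L\to +\infty}L^{\frac{2\delta}{1+4 \delta}}\,\underline{\rho}(\mathcal{S}_1,\alpha,\beta)>0.$$ $(iii)$ If $\delta<\gamma/(1+2\gamma)$ and $\gamma\leq 1/2$, then $$\liminf_{L\to +\infty}L^{\frac{1}{2}}\,\underline{\rho}(\mathcal{S}_1,\alpha,\beta)>0.$$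
   Context: For $L>0$, one observes a Poisson process $N$ on $[0,1]$ with intensity $s\ge 0$, $s\in\mathbb{L}^2([0,1])$, with respect to the measure $d\mu(x)=L\,dx$ (so its mean measure is $L s(x)dx$); $\mathbb{P}_s$ denotes its distribution. $\|\cdot\|$, $\langle\cdot,\cdot\rangle$ and $d$ are the norm, scalar product and distance of $\mathbb{L}^2([0,1],dx)$. $\mathcal{S}_0$ is the set of constant functions on $[0,1]$. The null hypothesis is ''$s\in\mathcal{S}_0$''. A test $\Phi_\alpha$ is a $\{0,1\}$-valued function of the observation $N$ (rejection when $\Phi_\alpha=1$); it has level $\alpha$ if $\mathbb{P}_s(\Phi_\alpha=1)\le\alpha$ for every intensity $s\in\mathcal{S}_0$. Uniform separation rate of $\Phi_\alpha$ over a class $\mathcal{S}_1$: $$\rho(\Phi_\alpha,\mathcal{S}_1,\beta)=\inf\Big\{\rho>0:\ \sup_{s\in\mathcal{S}_1,\ d(s,\mathcal{S}_0)>\rho}\mathbb{P}_s(\Phi_\alpha=0)\le\beta\Big\},$$ and $\underline{\rho}(\mathcal{S}_1,\alpha,\beta)=\inf_{\Phi_\alpha}\rho(\Phi_\alpha,\mathcal{S}_1,\beta)$, the infimum being over all level $\alpha$ tests (this quantity depends on $L$). Haar basis: $\phi_0=\mathbf{1}_{[0,1]}$, $\phi_{(j,k)}(x)=2^{j/2}\psi(2^jx-k)$ for $j\in\mathbb{N}$, $k\in\{0,\dots,2^j-1\}$, with $\psi=\mathbf{1}_{[0,1/2[}-\mathbf{1}_{[1/2,1[}$. Put $\alpha_0=\langle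 s,\phi_0\rangle$, $\alpha_{(j,k)}=\langle s,\phi_{(j,k)}\rangle$. Then $$\mathcal{B}_{2,\infty}^\delta(R)=\Big\{s\ge0,\ s\in\mathbb{L}^2([0,1]):\ \forall j\in\mathbb{N},\ \sum_{k=0}^{2^j-1}\alpha_{(j,k)}^2\le R^2 2^{-2j\delta}\Big\},$$ $$W_\gamma(R')=\Big\{s\ge0,\ s\in\mathbb{L}^2([0,1]):\ \forall t>0,\ \sum_{j\in\mathbb{N}}\sum_{k=0}^{2^j-1}\alpha_{(j,k)}^2\mathbf{1}_{\alpha_{(j,k)}^2\le t}\le R'^2t^{\frac{2\gamma}{1+2\gamma}}\Big\},$$ and $\mathbb{L}^\infty(R'')$ is the set of functions on $[0,1]$ bounded by $R''$. *)

(* Defs.v *)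
From HB Require Import structures.
From mathcomp Require Import all_boot all_order all_algebra.
From mathcomp Require Import all_classical all_reals all_analysis.
From mathcomp Require Import measurable_realfun.

Set Implicit Arguments.
Unset Strict Implicit.
Unset Printing Implicit Defensive.

Import Order.TTheory GRing.Theory Num.Theory.
Import numFieldNormedType.Exports.

Local Open Scope classical_set_scope.
Local Open Scope ring_scope.

Lemma lebesgue_measure_unit_itv (R : realType) :
  (@lebesgue_measure R `[0%R, 1%R]%classic < +oo)%E.
Proof. by rewrite lebesgue_measure_itv/= lte_fin ltr01 -EFinB ltry. Qed.

(* dx on [0,1]. A function on [0,1] is represented by a function R -> R;
   its values outside [0,1] are irrelevant to leb01. *)
Definition leb01 (R : realType)
    : {finite_measure set (measurableTypeR R) -> \bar R} :=
  @mfrestr _ (measurableTypeR R) _ _ _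
    (measurable_itv `[0%R, 1%R]) (@lebesgue_measure_unit_itv R).

Section function_classes.
Context (R : realType).
Implicit Types (s f g : R -> R).

Definition inner01 f g : R := \int[@leb01 R]_x (f x * g x).

Definition norm01 f : \bar R := 'N[@leb01 R]_2%:E[EFin \o f]%E.

Definition dist01 s (S : set (R -> R)) : \bar R :=
  ereal_inf [set norm01 (s \- t) | t in S].

Definition intensity s : Prop :=
  s \in Lfun (@leb01 R) 2%:E /\ {in `[0, 1], forall x, 0 <= s x}.

Definition constant_funs : set (R -> R) := range (fun c : R => cst c).

Definition haar_psi (x : R) : R := \1_`[0, 2^-1[ x - \1_`[2^-1, 1[ x.

Definition haar (j k : nat) (x : R) : R :=
  2 `^ (j%:R / 2) * haar_psi (2 ^+ j * x - k%:R).

Definition haar_coef s (j k : nat) : R := inner01 s (haar j k).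

Definition besov_body (delta r : R) : set (R -> R) :=
  [set s | intensity s /\
    forall j : nat, \sum_(k < 2 ^ j) haar_coef s j k ^+ 2
                    <= r ^+ 2 * 2 `^ (- (2 * j%:R * delta))].

Definition weak_besov_body (gamma r : R) : set (R -> R) :=
  [set s | intensity s /\
    forall t : R, 0 < t ->
      (\sum_(0 <= j <oo)
          (\sum_(k < 2 ^ j)
              haar_coef s j k ^+ 2 * (haar_coef s j k ^+ 2 <= t)%R%:R)%:E
       <= (r ^+ 2 * t `^ (2 * gamma / (1 + 2 * gamma)))%:E)%E].

Definition bounded_by (r : R) : set (R -> R) :=
  [set s | {in `[0, 1], forall x, `|s x| <= r}].

End function_classes.

Section poisson_process.
Context (R : realType) (d : measure_display) (Omega : measurableType d).

(* The kernel N is a random measure; under P it is a Poisson process on [0,1]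
   with mean measure nu. The second argument of poisson_prob is a dummy. *)
Definition poisson_process (P : probability Omega R)
    (N : R.-ker Omega ~> measurableTypeR R) (nu : set (measurableTypeR R) -> R) : Prop :=
  [/\ (forall w, N w (~` `[0, 1]) = 0%E)
      /\ (forall w A, measurable A -> exists n : nat, N w A = n%:R%:E),
      (forall A (n : nat), measurable A ->
         P [set w | N w A = n%:R%:E] = poisson_prob (nu A) 0 [set n]) &
      (forall n (A : 'I_n -> set (measurableTypeR R)) (B : 'I_n -> set (\bar R)),
         (forall i, measurable (A i)) -> trivIset setT A ->
         (forall i, measurable (B i)) ->
         P [set w | forall i, B i (N w (A i))]
         = (\prod_(i < n) P [set w | B i (N w (A i))])%E)].

Definition mean_measure (L : R) (s : R -> R) (A : set (measurableTypeR R))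
    : R :=
  L * \int[@leb01 R]_(x in A) s x.

Definition observation : Type := {measure set (measurableTypeR R) -> \bar R}.

Definition observation_events : set (set observation) :=
  <<s [set E | exists A B, [/\ measurable A, measurable B &
                            E = [set m : observation | B (m A)]] ]>>.

Definition is_test (Phi : observation -> bool) : Prop :=
  observation_events [set m | Phi m].

(* In what follows P s is the probability under which the observed process N
   has intensity s (the scale L being fixed). *)
Implicit Types (P : (R -> R) -> probability Omega R)
  (N : R.-ker Omega ~> measurableTypeR R) (Phi : observation -> bool).

Definition level_tests P N (alpha : R) : set (observation -> bool) :=
  [set Phi | is_test Phi /\
    forall s, constant_funs s -> intensity s ->
      (P s [set w | Phi (N w)] <= alpha%:E)%E].

Definition separation_rate P N (S1 : set (R -> R)) (beta : R) Phi : \bar R :=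
  ereal_inf [set rho%:E | rho in [set rho : R | 0 < rho /\
    (ereal_sup [set P s [set w | ~~ Phi (N w)] |
        s in [set s | S1 s /\ rho%:E < dist01 s (@constant_funs R)]]
     <= beta%:E)%E]].

Definition minimax_separation_rate P N (S1 : set (R -> R)) (alpha beta : R)
    : \bar R :=
  ereal_inf [set separation_rate P N S1 beta Phi | Phi in level_tests P N alpha].

End poisson_process.

(* Main.v *)
(* Test the intensity 1 against the mixture of the intensities
     s_f = 1 + a sum_b sign_b phi_(J, k_b),   J = p + q,
   where the 2^J wavelets of level J are cut into 2^p blocks of 2^q consecutive
   ones and f picks, in each block b, one wavelet k_b and a sign. On a dyadic
   grid these intensities are step functions, so the likelihood ratio Z_f of s_f
   against 1 only depends on the numbers of points in the cells. The product
   Z_f Z_g is exp (L <s_f - 1, s_g - 1>) times the likelihood ratio of the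
   intensity s_f s_g, so it has expectation exp (L <s_f - 1, s_g - 1>).
   Averaging over f and g factorizes over the blocks: with u = L a^2, the
   second moment of the mixed likelihood ratio is
     (1 + (cosh u - 1) / 2^q)^(2^p),
   and as soon as it is at most 29/25 a level alpha test misses some s_f with
   probability at least 3/5 - alpha > beta. All s_f are at distance at least
   a 2^(p/2) from the constants. The three rates come from three choices of
   (p, q, a): a single wavelet (p = q = 0) for the parametric rate, and one
   wavelet per block at a high level J for the two others. *)
Require Import Defs.
From mathcomp Require Import all_boot all_order all_algebra.
From mathcomp Require Import all_classical all_reals all_analysis.
From mathcomp Require Import measurable_realfun.
From mathcomp Require Import ring lra zify.

Set Implicit Arguments.
Unset Strict Implicit.
Unset Printing Implicit Defensive.

Import Order.TTheory GRing.Theory Num.Theory.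
Import numFieldNormedType.Exports.

Local Open Scope classical_set_scope.
Local Open Scope ring_scope.

(** * Testing errors bounded below by a second moment *)

(* The tangent bounds z <= 1 + (5/4) (z - 1)^2 + 1/5 on F and
   0 <= (5/4) (z - 1)^2 + 1/5 off F replace the Cauchy-Schwarz inequality. *)
Lemma chi2_error_lb (R : realType) (d : measure_display) (T : measurableType d)
    (P : probability T R) (z : T -> R) (F : set T) :
  measurable F -> measurable_fun setT z -> (forall w, 0 <= z w) ->
  (\int[P]_w (z w)%:E = 1)%E -> (\int[P]_w (z w ^+ 2)%:E <= (29 / 25)%:E)%E ->
  ((3 / 5)%:E <= P F + \int[P]_(w in ~` F) (z w)%:E)%E.
Proof.
have c54 : (0 : R) <= 5 / 4 by lra.
have c72 : (0 : R) <= 7 / 2 by lra.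
have c52 : (0 : R) <= 5 / 2 by lra.
have c4920 : (0 : R) <= 49 / 20 by lra.
have c2920 : (0 : R) <= 29 / 20 by lra.
(* The two tangent bounds in expanded form: the difference of the two sides is
   [(5 * y - 7) ^+ 2 / 20] in the first and [5 / 4 * (y - 1) ^+ 2 + 1 / 5] in the second. *)
have q1 (y : R) : 7 / 2 * y <= 5 / 4 * y ^+ 2 + 49 / 20.
  by have := sqr_ge0 (5 * y - 7); lra.
have q2 (y : R) : 5 / 2 * y <= 5 / 4 * y ^+ 2 + 29 / 20.
  by have := sqr_ge0 (y - 1); lra.
move=> mF mz z0 z1 z2.
have mzA A : measurable_fun A (fun w => (z w)%:E).
  by apply/measurable_EFinP; exact: measurable_funTS.
have mz2A A : measurable_fun A (fun w => (z w ^+ 2)%:E).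
  by apply/measurable_EFinP; apply: measurable_funTS; exact: measurable_funX.
have z_ge0 A w : A w -> (0 <= (z w)%:E)%E by rewrite lee_fin.
have z2_ge0 A w : A w -> (0 <= (z w ^+ 2)%:E)%E by rewrite lee_fin sqr_ge0.
have mFC := measurableC mF.
have tangent A (a b : R) : measurable A -> 0 <= a -> 0 <= b ->
    (forall w, A w -> a * z w <= 5 / 4 * z w ^+ 2 + b) ->
    (a%:E * \int[P]_(w in A) (z w)%:E <=
     (5 / 4)%:E * \int[P]_(w in A) (z w ^+ 2)%:E + b%:E * P A)%E.
  move=> mA a0 b0 H.
  rewrite -integral_cst// -!ge0_integralZl_EFin//.
  rewrite -ge0_integralD//=.
  - apply: ge0_le_integral => //=.
    + by move=> w _; rewrite -EFinM lee_fin mulr_ge0.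
    + exact: emeasurable_funM.
    + apply: emeasurable_funD => //; exact: emeasurable_funM.
  - by move=> w _; rewrite -EFinM lee_fin mulr_ge0 ?sqr_ge0.
  - exact: emeasurable_funM.
  - exact: z2_ge0.
  - exact: z_ge0.
have split_int (f : T -> \bar R) : measurable_fun setT f -> (forall w, 0 <= f w)%E ->
    (\int[P]_w f w = \int[P]_(w in F) f w + \int[P]_(w in ~` F) f w)%E.
  move=> mf f0; rewrite -[X in (\int[P]_(w in X) _)%E](setUv F).
  by rewrite ge0_integral_setU//= ?setUv//; exact/disj_setPCl.
have tF := tangent F (7 / 2) (49 / 20) mF.
have tFC := tangent (~` F) (5 / 2) (29 / 20) mFC.
move: (tF c72 c4920 (fun w _ => q1 (z w))) (tFC c52 c2920 (fun w _ => q2 (z w))).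
move: z1 z2 => /[swap]; rewrite !split_int//; first last.
- by move=> w; rewrite lee_fin sqr_ge0.
rewrite probability_setC//.
have: (0 <= \int[P]_(w in F) (z w)%:E)%E by apply: integral_ge0 => w _; exact: z0.
have: (0 <= \int[P]_(w in ~` F) (z w)%:E)%E by apply: integral_ge0 => w _; exact: z0.
have: (0 <= \int[P]_(w in F) (z w ^+ 2)%:E)%E by apply: integral_ge0 => w _; exact: sqr_ge0.
have: (0 <= \int[P]_(w in ~` F) (z w ^+ 2)%:E)%E by apply: integral_ge0 => w _; exact: sqr_ge0.
move: (\int[P]_(w in F) (z w)%:E)%E (\int[P]_(w in ~` F) (z w)%:E)%E
  (\int[P]_(w in F) (z w ^+ 2)%:E)%E (\int[P]_(w in ~` F) (z w ^+ 2)%:E)%E.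
have : P F \is a fin_num by rewrite fin_num_measure.
move: (P F) => [p| |]// _ [a| |]// [b| |]// [e| |]// [f| |]//.
rewrite -!EFinM -!EFinD !lee_fin => f0 e0 b0 a0 H4 [H3] H1 H2.
(* With [a + b = 1] and [e + f <= 29 / 25], the sum of the two bounds reads
   [5 / 2 + a <= 29 / 10 + p], that is [3 / 5 <= p + b]. *)
lra.
Qed.

(** * Finite partitions and Poisson weights *)

Lemma measure_preimage_finType (d : measure_display) (T : measurableType d)
    (R : realType) (mu : {measure set T -> \bar R}) (J : finType) (e : T -> J)
    (Q : pred J) :
  (forall j, measurable (e @^-1` [set j])) ->
  mu (e @^-1` [set j | Q j]) = (\sum_(j | Q j) mu (e @^-1` [set j]))%E.
Proof.
move=> me.
have -> : e @^-1` [set j | Q j] = \bigcup_(j in [set j | Q j]) e @^-1` [set j].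
  by apply/seteqP; split => [x Qx|x [j Qj /= ->]]//; exists (e x).
rewrite measure_fin_bigcup//.
- rewrite (@bigfs _ _ _ _ (index_enum J) Q)// ?index_enum_uniq//.
  by move=> j _; rewrite mem_index_enum.
- exact: finite_finset.
- by move=> i j _ _ [x [/= <- <-]].
Qed.

Definition poisson_mass (R : realType) (x : R) (n : nat) : R :=
  x ^+ n * n`!%:R^-1 * expR (- x).

(** For a rate that is not positive [poisson_prob] is the Dirac mass at 0. The closed formula still
    agrees at [x = 0], where [x ^+ n] is 1 for [n = 0] and 0 otherwise; this case occurs for cells
    of weight zero. *)
Lemma poisson_prob_set1 (R : realType) (x : R) (k n : nat) : 0 <= x ->
  poisson_prob x k [set n] = (poisson_mass x n)%:E.
Proof.
move=> x0; rewrite /poisson_prob /poisson_mass; case: ifPn => [x1|].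
  by rewrite esum_set1/= ?lee_fin ?poisson_pmf_ge0// /poisson_pmf x1.
rewrite -leNgt => x1; have -> : x = 0 by apply/eqP; rewrite eq_le x1 x0.
rewrite oppr0 expR0 mulr1 diracE; case: n => [|n].
  by rewrite mem_set// expr0 fact0 invr1 mulr1.
by rewrite memNset//= expr0n/= mul0r.
Qed.

(** * Likelihood ratio of Poisson processes with step intensities *)

Section change_of_measure.
Context (R : realType) (d : measure_display) (Omega : measurableType d)
  (N : R.-ker Omega ~> measurableTypeR R) (L : R) (I : finType)
  (c : measurableTypeR R -> I).
Hypothesis mc : forall i, measurable (c @^-1` [set i]).

Definition cell_weight (A : set (measurableTypeR R)) : R := fine (leb01 R A).

Lemma mean_measure_step (v : I -> R) (i : I) (A : set (measurableTypeR R)) :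
  measurable A -> A `<=` c @^-1` [set i] ->
  mean_measure L (v \o c) A = L * (v i * cell_weight A).
Proof.
move=> mA Ai; rewrite /mean_measure; congr (_ * _).
rewrite -Rintegral_cst//; apply: eq_Rintegral => x /set_mem /Ai /= <- //.
Qed.

(** A natural number, so that it can be an exponent in [density]. Truncation loses nothing, since
    the counts of a Poisson process are integers ([points_E]). *)
Definition points (A : set (measurableTypeR R)) (w : Omega) : nat :=
  Num.truncn (fine (N w A)).

(* The likelihood ratio of the intensity v \o c with respect to the intensity 1. *)
Definition density (v : I -> R) (w : Omega) : R :=
  \prod_i (expR (- (L * (v i - 1) * cell_weight (c @^-1` [set i])))
            * v i ^+ points (c @^-1` [set i]) w).

Section given_poisson.
Context (nu : set (measurableTypeR R) -> R) (P : probability Omega R).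
Hypothesis hP : poisson_process P N nu.

Lemma points_E A w : measurable A -> N w A = (points A w)%:R%:E.
Proof.
by move=> mA; case: hP => -[_ /(_ w A mA)[n En]] _ _; rewrite /points En/= natrK.
Qed.

Lemma measurable_points_eq A n : measurable A ->
  measurable [set w | points A w = n].
Proof.
move=> mA; have -> : [set w | points A w = n] = (N ^~ A) @^-1` [set n%:R%:E].
  apply/seteqP; split => w /=; rewrite points_E//; first by move=> ->.
  by case=> /eqP; rewrite eqr_nat => /eqP.
rewrite -[X in measurable X]setTI; apply: measurable_kernel => //.
Qed.

Lemma measurable_points A : measurable A -> measurable_fun setT (points A).
Proof.
move=> mA _ Y _; rewrite setTI.
have -> : points A @^-1` Y = \bigcup_(n in Y) [set w | points A w = n].
  by apply/seteqP; split => [w Yw|w [n Yn /= wn]]; [exists (points A w) | rewrite /= wn].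
by apply: bigcup_measurable => n _; exact: measurable_points_eq.
Qed.

Lemma measurable_density v : measurable_fun setT (density v).
Proof.
apply: measurable_prod => i _; apply: measurable_funM; first exact: measurable_cst.
apply: (@measurableT_comp _ _ _ _ _ _ (fun n : nat => v i ^+ n)) => //.
exact: measurable_points.
Qed.

Lemma points_atoms (J : finType) (e : measurableTypeR R -> J) (k : J -> nat) :
  (forall j, measurable (e @^-1` [set j])) ->
  (forall j, 0 <= nu (e @^-1` [set j])) ->
  P [set w | forall j, points (e @^-1` [set j]) w = k j]
  = (\prod_j poisson_mass (nu (e @^-1` [set j])) (k j))%:E.
Proof.
move=> me nu0; case: (hP) => _ hlaw hind.
(* Independence is given for families indexed by ['I_n], so the cells are enumerated. *)
have -> : [set w | forall j, points (e @^-1` [set j]) w = k j] =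
  [set w | forall i : 'I_#|J|,
     [set (k (enum_val i))%:R%:E] (N w (e @^-1` [set enum_val i]))].
  apply/seteqP; split => w /= H.
    by move=> i; rewrite points_E// H.
  move=> j; have := H (enum_rank j); rewrite enum_rankK points_E// => -[] /eqP.
  by rewrite eqr_nat => /eqP.
have tr : trivIset setT (fun i : 'I_#|J| => e @^-1` [set enum_val i]).
  by move=> i j _ _ [x [/= -> /enum_val_inj]].
rewrite (hind _ (fun i => e @^-1` [set enum_val i])
  (fun i => [set (k (enum_val i))%:R%:E]))//.
rewrite -prodEFin (reindex (fun i : 'I_#|J| => enum_val i))/=; last first.
  exact/onW_bij/enum_val_bij.
by apply: eq_bigr => i _; rewrite hlaw// poisson_prob_set1.

Qed.

End given_poisson.

(** The likelihood ratio in a single cell of weight [m] containing [k] points; it is one factor of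
    [density]. *)
Lemma poisson_mass_tilt (v m : R) (k : nat) :
  poisson_mass (L * (v * m)) k
  = expR (- (L * (v - 1) * m)) * v ^+ k * poisson_mass (L * (1 * m)) k.
Proof.
rewrite /poisson_mass mul1r.
have -> : - (L * (v * m)) = - (L * (v - 1) * m) + - (L * m) by ring.
by rewrite expRD !exprMn; ring.
Qed.

Section density_of_law.
Context (v : I -> R) (P1 Pv : probability Omega R).
Hypotheses (L0 : 0 < L) (v0 : forall i, 0 <= v i).
Hypothesis hP1 : poisson_process P1 N (mean_measure L ((fun=> 1) \o c)).
Hypothesis hPv : poisson_process Pv N (mean_measure L (v \o c)).

Section refined.
Context (J : finType) (e : measurableTypeR R -> J) (pi : J -> I).
Hypotheses (me : forall j, measurable (e @^-1` [set j])) (cE : c = pi \o e).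

Lemma preimage_cell i : c @^-1` [set i] = e @^-1` [set j | pi j == i].
Proof. by rewrite cE; apply/seteqP; split => x /= /eqP. Qed.

Lemma cell_weight_sum i :
  cell_weight (c @^-1` [set i])
  = \sum_(j | pi j == i) cell_weight (e @^-1` [set j]).
Proof.
rewrite /cell_weight preimage_cell measure_preimage_finType//.
rewrite -sum_fine// => j _; exact: fin_num_measure.
Qed.

Lemma points_sum (w : Omega) (Q : pred J) :
  points (e @^-1` [set j | Q j]) w
  = (\sum_(j | Q j) points (e @^-1` [set j]) w)%N.
Proof.
apply/eqP; rewrite -(eqr_nat R) -eqe -(points_E hP1)//; last first.
  have -> : e @^-1` [set j | Q j] = \bigcup_(j in [set j | Q j]) e @^-1` [set j].
    by apply/seteqP; split => [x Qx|x [j Qj /= ->]]//; exists (e x).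
  by apply: fin_bigcup_measurable => //; exact: finite_finset.
rewrite measure_preimage_finType// natr_sum -sumEFin; apply/eqP/eq_bigr => j _.
by rewrite (points_E hP1).
Qed.

(** Events about sets that cut the cells of [c] require a finer partition [e]. Weights and counts
    add up over the fine cells inside a coarse one, so exponentials and powers multiply and the
    density factorizes over [e] as well. *)
Lemma density_atom (k : J -> nat) (w : Omega) :
  (forall j, points (e @^-1` [set j]) w = k j) ->
  density v w = \prod_j (expR (- (L * (v (pi j) - 1) * cell_weight (e @^-1` [set j])))
                         * v (pi j) ^+ k j).
Proof.
move=> wk; rewrite /density [RHS](partition_big pi xpredT)//=.
apply: eq_bigr => i _; rewrite cell_weight_sum preimage_cell points_sum.
under [RHS]eq_bigr => j /eqP -> do rewrite -(wk j).
by rewrite big_split/= -expR_sum -expr_sum mulr_sumr sumrN.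
Qed.

(** The density is constant once all fine counts are fixed. Both probabilities are products of
    Poisson weights, and they match factor by factor through [poisson_mass_tilt]. *)
Lemma law_atom (k : J -> nat) :
  (Pv [set w | forall j, points (e @^-1` [set j]) w = k j]
   = \int[P1]_(w in [set w | forall j, points (e @^-1` [set j]) w = k j])
       (density v w)%:E)%E.
Proof.
set F := [set w | _].
have mF : measurable F.
  have -> : F = \bigcap_(j in [set: J]) [set w | points (e @^-1` [set j]) w = k j].
    by apply/seteqP; split => w H j; [move=> _; exact: H|exact: (H j Logic.I)].
  apply: fin_bigcap_measurable => // j _; exact: (measurable_points_eq hP1).
have cell j : e @^-1` [set j] `<=` c @^-1` [set pi j] by rewrite cE => x /= ->.
have W0 j : 0 <= cell_weight (e @^-1` [set j]) by rewrite fine_ge0.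
have nu0 (u : I -> R) : (forall i, 0 <= u i) ->
    forall j, 0 <= mean_measure L (u \o c) (e @^-1` [set j]).
  move=> u0 j; rewrite (mean_measure_step u (me j) (cell j)).
  by rewrite !mulr_ge0// ltW.
under eq_integral => w /set_mem wF do rewrite (density_atom wF).
rewrite integral_cst//= /F (points_atoms hPv)//; last exact: nu0.
rewrite (points_atoms hP1)//; last exact: nu0.
rewrite -EFinM -big_split/=; congr EFin; apply: eq_bigr => j _.
rewrite (mean_measure_step v (me j) (cell j)).
rewrite (mean_measure_step (fun=> 1) (me j) (cell j)).
exact: poisson_mass_tilt.
Qed.

End refined.

Lemma density_ge0 w : 0 <= density v w.
Proof. by apply: prodr_ge0 => i _; rewrite mulr_ge0 ?expR_ge0 ?exprn_ge0. Qed.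

Lemma law_bigcup (F : (set Omega)^nat) :
  (forall n, measurable (F n)) -> trivIset setT F ->
  (forall n, Pv (F n) = \int[P1]_(w in F n) (density v w)%:E)%E ->
  (Pv (\bigcup_n F n) = \int[P1]_(w in \bigcup_n F n) (density v w)%:E)%E.
Proof.
move=> mF tF FE; rewrite ge0_integral_bigcup//.
- rewrite measure_bigcup// (@eq_eseriesl _ _ xpredT) => [|n]; last first.
    exact: in_setT.
  by apply: eq_eseriesr => n _; exact: FE.
- apply/measurable_EFinP; apply: measurable_funTS; exact: (measurable_density hP1).
- by move=> w _; rewrite lee_fin density_ge0.
Qed.

(** The vector of counts lives in a countable type, so an event about it is a countable disjoint
    union of atoms; [Fn n] is the atom whose vector has code [n], or is empty. *)
Lemma law_configurations (J : finType) (e : measurableTypeR R -> J) (pi : J -> I)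
    (Y : set {ffun J -> nat}) :
  (forall j, measurable (e @^-1` [set j])) -> c = pi \o e ->
  let F := [set w | Y [ffun j => points (e @^-1` [set j]) w]] in
  measurable F /\ (Pv F = \int[P1]_(w in F) (density v w)%:E)%E.
Proof.
move=> me cE F.
pose prof w := [ffun j => points (e @^-1` [set j]) w].
pose Fn n := [set w | Y (prof w) /\ pickle (prof w) = n].
have FE : F = \bigcup_n Fn n.
  by apply/seteqP; split => [w Yw|w [n _ []]]//; exists (pickle (prof w)).
have Fn0 n : Fn n = set0 \/ exists2 k : {ffun J -> nat}, Y k &
    Fn n = [set w | forall j, points (e @^-1` [set j]) w = k j].
  have [[w [Yw wn]]|] := pselect (exists w, Fn n w); last first.
    by move=> H; left; rewrite -subset0 => w Fw; apply: H; exists w.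
  right; exists (prof w) => //; apply/seteqP; split => [w' [Yw' wn'] j|w' w'E].
    have -> : prof w = prof w' by apply: (pcan_inj pickleK); rewrite wn wn'.
    by rewrite ffunE.
  have E : prof w' = prof w by apply/ffunP => j; rewrite ffunE w'E.
  by rewrite /Fn/= E.
have mFn n : measurable (Fn n).
  have [->//|[k _ ->]] := Fn0 n.
  have -> : [set w | forall j, points (e @^-1` [set j]) w = k j]
      = \bigcap_(j in [set: J]) [set w | points (e @^-1` [set j]) w = k j].
    by apply/seteqP; split => w H j; [move=> _; exact: H|exact: (H j Logic.I)].
  by apply: fin_bigcap_measurable => // j _; exact: (measurable_points_eq hP1).
split; first by rewrite FE; exact: bigcup_measurable.
rewrite FE; apply: law_bigcup => //.
- by move=> i j _ _ [w [[_ <-] [_ <-]]].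
- move=> n; have [->|[k _ ->]] := Fn0 n; first by rewrite measure0 integral_set0.
  exact: (law_atom me cE).
Qed.

(** The generators of [observation_events] constrain the count of one set and need not be stable
    under intersection. Finite conjunctions form the pi-system that the Dynkin argument needs. *)
Definition cylinders : set (set (observation R)) :=
  [set E | exists (n : nat) (A : 'I_n -> set (measurableTypeR R))
      (B : 'I_n -> set (\bar R)),
    [/\ forall i, measurable (A i), forall i, measurable (B i) &
        E = [set m : observation R | forall i, B i (m (A i))]]].

Lemma setI_closed_cylinders : setI_closed cylinders.
Proof.
move=> _ _ [n1 [A1 [B1 [mA1 mB1 ->]]]] [n2 [A2 [B2 [mA2 mB2 ->]]]].
exists (n1 + n2)%N,
  (fun i : 'I_(n1 + n2) =>
     match fintype.split i with inl j => A1 j | inr j => A2 j end),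
  (fun i : 'I_(n1 + n2) =>
     match fintype.split i with inl j => B1 j | inr j => B2 j end); split.
- by move=> i; case: fintype.split.
- by move=> i; case: fintype.split.
- apply/seteqP; split => m /=.
    by move=> [H1 H2] i; case: fintype.split.
  move=> H; split=> i.
    by have := H (lshift n2 i); rewrite (unsplitK (inl i)).
  by have := H (rshift n1 i); rewrite (unsplitK (inr i)).
Qed.

Lemma sub_cylinders : observation_events (R := R) `<=` <<s cylinders >>.
Proof.
apply: smallest_sub; first exact: smallest_sigma_algebra.
move=> E [A [B [mA mB ->]]].
apply: sub_gen_smallest; exists 1%N, (fun=> A), (fun=> B); split => //.
by apply/seteqP; split => m //= H; exact: (H ord0).
Qed.

(** The sets [A i] may overlap and cut cells. Classifying each point by the [A i] that contain it
    and by its cell gives a finite partition finer than [c], and the count of [A i] is the sum over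
    the classes inside it. *)
Lemma law_cylinder (E : set (observation R)) : cylinders E ->
  measurable [set w | E (N w)] /\
  (Pv [set w | E (N w)] = \int[P1]_(w in [set w | E (N w)]) (density v w)%:E)%E.
Proof.
move=> [n [A [B [mA mB ->]]]].
pose e (x : measurableTypeR R) : ({ffun 'I_n -> bool} * I)%type :=
  ([ffun i => `[< A i x >]], c x).
have me j : measurable (e @^-1` [set j]).
  have -> : e @^-1` [set j] = c @^-1` [set j.2] `&`
      \bigcap_(i in [set: 'I_n]) (if j.1 i then A i else ~` A i).
    apply/seteqP; split => [x /= <-|x [/= cx Ax]] /=.
      by split => // i _; rewrite ffunE; case: asboolP.
    rewrite /e cx; case: j cx Ax => f i /= _ Ax; congr pair.
    apply/ffunP => k; rewrite ffunE; have /= := Ax k Logic.I.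
    by case: (f k) => /asboolP; [move=> ->|rewrite asbool_neg => /negbTE ->].
  apply: measurableI => //; apply: fin_bigcap_measurable => //= i _.
  by case: ifP => _ //; exact: measurableC.
pose Y : set {ffun ({ffun 'I_n -> bool} * I)%type -> nat} :=
  [set k | forall i, B i (\sum_(j : {ffun 'I_n -> bool} * I | j.1 i) k j)%N%:R%:E].
have := law_configurations Y me (erefl (snd \o e)); set F := [set w | Y _].
suff -> : F = [set w | forall i, B i (N w (A i))] by [].
apply/seteqP; split => w /= H i; have := H i;
  (have -> : N w (A i) = (\sum_(j : {ffun 'I_n -> bool} * I | j.1 i)
     [ffun j => points (e @^-1` [set j]) w] j)%N%:R%:E;
  last by []).
all: under eq_bigr do rewrite ffunE; rewrite -(points_sum me w (fun j => j.1 i)).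
all: rewrite (points_E hP1)//; congr (_%:R%:E); congr points.
all: by apply/seteqP; split => x /=; rewrite ffunE => /asboolP.
Qed.

(** Dynkin's pi-lambda theorem: the events [E] with both properties contain the cylinders and are
    closed under complements and countable disjoint unions. *)
Lemma law_density (E : set (observation R)) : observation_events E ->
  measurable [set w | E (N w)] /\
  (Pv [set w | E (N w)] = \int[P1]_(w in [set w | E (N w)]) (density v w)%:E)%E.
Proof.
pose H := [set E : set (observation R) | measurable [set w | E (N w)] /\
  (Pv [set w | E (N w)] = \int[P1]_(w in [set w | E (N w)]) (density v w)%:E)%E].
move=> /sub_cylinders; rewrite -(setI_closed_g_dynkin_g_sigma_algebra setI_closed_cylinders).
suff : <<d cylinders >> `<=` H by move=> /(_ E).
have HT : H setT.
  apply: law_cylinder; exists 0%N, (fun=> setT), (fun=> setT); split => //.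
  by apply/seteqP; split => // m _ [].
have mZ A : measurable_fun A (fun w => (density v w)%:E).
  by apply/measurable_EFinP; apply: measurable_funTS; exact: (measurable_density hP1).
apply: smallest_sub; last exact: law_cylinder.
split => //.
- move=> F [mF FE]; set F' := [set w | F (N w)] in mF FE.
  suff : measurable (~` F') /\
    (Pv (~` F') = \int[P1]_(w in ~` F') (density v w)%:E)%E by [].
  split; first exact: measurableC.
  have : (Pv setT = \int[P1]_(w in setT) (density v w)%:E)%E by case: HT.
  rewrite probability_setT -[X in (\int[P1]_(w in X) _)%E](setUv F').
  rewrite ge0_integral_setU//=; last 3 first.
  + exact: measurableC.
  + by move=> w _; rewrite lee_fin density_ge0.
  + by apply/disj_setPCl.
  rewrite -FE probability_setC// => ->.
  rewrite addeAC subee ?add0e//.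
  by rewrite fin_num_measure.
- move=> F tF HF.
  pose G k := [set w | F k (N w)].
  suff : measurable (\bigcup_k G k) /\
    (Pv (\bigcup_k G k) = \int[P1]_(w in \bigcup_k G k) (density v w)%:E)%E by [].
  split; first by apply: bigcup_measurable => k _; case: (HF k).
  apply: law_bigcup.
  + by move=> k; case: (HF k).
  + by move=> i j _ _ [w [Fi Fj]]; apply: (tF i j) => //; exists (N w).
  + by move=> k; case: (HF k).
Qed.

End density_of_law.

(** In each cell [- (u - 1) - (v - 1) = (u - 1) * (v - 1) - (u * v - 1)], and the powers of [u] and
    [v] merge into powers of [u * v]. *)
Lemma density_mul (u v : I -> R) (w : Omega) :
  density u w * density v w
  = expR (L * \sum_i cell_weight (c @^-1` [set i]) * ((u i - 1) * (v i - 1)))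
    * density (fun i => u i * v i) w.
Proof.
rewrite mulr_sumr expR_sum -!big_split/=; apply: eq_bigr => i _.
rewrite exprMn [LHS]mulrACA [RHS]mulrA -!expRD; congr (expR _ * _); ring.
Qed.

(** * Mixtures of alternatives and undetected intensities *)

Section testing.
Context (P : (I -> R) -> probability Omega R).
Hypotheses (L0 : 0 < L) (hP : forall v : I -> R, (forall i, 0 <= v i) ->
  poisson_process (P v) N (mean_measure L (v \o c))).

Let law v (v0 : forall i, 0 <= v i) :=
  law_density L0 v0 (hP (fun=> ler01)) (hP v0).

Lemma integral_density (v : I -> R) : (forall i, 0 <= v i) ->
  (\int[P (fun=> 1%R)]_w (density v w)%:E = 1)%E.
Proof.
move=> v0.
have ET : observation_events (R := R) setT.
  apply: sub_gen_smallest; exists set0, setT; split => //.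
by have [_] := law v0 ET; rewrite probability_setT.
Qed.

(** Let [z] be the uniform mixture of the densities. The double sum controls its second moment, so
    [chi2_error_lb] makes the level plus the average miss probability at least 3/5. If every miss
    were at most [beta], this sum would be at most 59/100. *)
Lemma exists_undetected (X : finType) (v : X -> I -> R)
    (E : set (observation R)) (alpha beta : R) :
  (0 < #|X|)%N -> (forall x i, 0 <= v x i) -> observation_events E ->
  \sum_x \sum_y
    expR (L * \sum_i cell_weight (c @^-1` [set i]) * ((v x i - 1) * (v y i - 1)))
  <= 29 / 25 * #|X|%:R ^+ 2 ->
  alpha + beta <= 59 / 100 ->
  (P (fun=> 1%R) [set w | E (N w)] <= alpha%:E)%E ->
  exists x, (beta%:E < P (v x) [set w | ~ E (N w)])%E.
Proof.
move=> X0 v0 hE chi2 ab levelE; apply/not_existsP => /= small.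
set n : R := #|X|%:R in chi2 *; have n0 : 0 < n by rewrite ltr0n.
pose z w := \sum_x n^-1 * density (v x) w.
have mZ x := measurable_density (hP (fun=> ler01)) (v x).
have Z0 x w : 0 <= density (v x) w by exact: density_ge0.
have mF := (law (v0 (enum_val (Ordinal X0))) hE).1.
set F := [set w | E (N w)] in levelE mF.
have FC x : (P (v x) (~` F) = \int[P (fun=> 1%R)]_(w in ~` F) (density (v x) w)%:E)%E.
  have hEC : observation_events (~` E).
    rewrite -setTD; have [_ + _] := @smallest_sigma_algebra _ setT
      [set E | exists A B, [/\ measurable A, measurable B &
                            E = [set m : observation R | B (m A)]] ].
    exact.
  exact: (law (v0 x) hEC).2.
have int_z A : measurable A -> (\int[P (fun=> 1%R)]_(w in A) (z w)%:E =
    \sum_x n^-1%:E * \int[P (fun=> 1%R)]_(w in A) (density (v x) w)%:E)%E.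
  move=> mA; under eq_integral do rewrite /z -sumEFin.
  rewrite ge0_integral_sum//.
  - apply: eq_bigr => x _; under eq_integral do rewrite EFinM.
    rewrite ge0_integralZl_EFin//.
    + by move=> w _; rewrite lee_fin.
    + by apply/measurable_EFinP; exact: measurable_funTS.
    + by rewrite invr_ge0 ltW.
  - move=> x; apply/measurable_EFinP/measurable_funTS; exact: measurable_funM.
  - by move=> x w _; rewrite lee_fin mulr_ge0// invr_ge0 ltW.
have mz : measurable_fun setT z.
  by apply: measurable_sum => x; exact: measurable_funM.
have z0 w : 0 <= z w by apply: sumr_ge0 => x _; rewrite mulr_ge0// invr_ge0 ltW.
have sum_n (y : R) : \sum_(x : X) n^-1 * y = y.
  by rewrite big_const iter_addr addr0 -mulr_natl -/n mulVKf ?gt_eqF.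
have z1 : (\int[P (fun=> 1%R)]_w (z w)%:E = 1)%E.
  rewrite int_z//; under eq_bigr => x _ do rewrite integral_density// -EFinM.
  by rewrite sumEFin sum_n.
have z2 : (\int[P (fun=> 1%R)]_w (z w ^+ 2)%:E <= (29 / 25)%:E)%E.
  pose K x y := expR (L * \sum_i cell_weight (c @^-1` [set i]) * ((v x i - 1) * (v y i - 1))).
  (* The square expands into densities of the product intensities [v x * v y]. These are again
     nonnegative step functions, so each such density integrates to 1 and only the factors [K x y]
     remain. *)
  have zE w : ((z w ^+ 2)%:E = \sum_x \sum_y
      (n ^- 2 * K x y)%:E * (density (fun i => v x i * v y i) w)%:E)%E.
    rewrite expr2 /z mulr_suml -sumEFin; apply: eq_bigr => x _.
    rewrite mulr_sumr -sumEFin; apply: eq_bigr => y _.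
    by rewrite mulrACA density_mul -EFinM -expr2 exprVn mulrA.
  have K0 x y : 0 <= n ^- 2 * K x y.
    by rewrite mulr_ge0 ?expR_ge0// invr_ge0 exprn_ge0// ltW.
  have D0 x y w : 0 <= density (fun i => v x i * v y i) w.
    by apply: density_ge0 => i; rewrite mulr_ge0.
  have mD x y : measurable_fun setT (fun w => (density (fun i => v x i * v y i) w)%:E).
    by apply/measurable_EFinP; exact: (measurable_density (hP (fun=> ler01))).
  under eq_integral do rewrite zE.
  have T0 x y w : (0 <= (n ^- 2 * K x y)%:E * (density (fun i => v x i * v y i) w)%:E)%E.
    by rewrite -EFinM lee_fin mulr_ge0.
  rewrite ge0_integral_sum//; first last.
  - by move=> x w _; apply: sume_ge0.
  - by move=> x; apply: emeasurable_sum => y; exact: emeasurable_funM.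
  under eq_bigr => x _.
    rewrite ge0_integral_sum//; last by move=> y; exact: emeasurable_funM.
    under eq_bigr => y _.
      rewrite ge0_integralZl_EFin//; last by move=> w _; rewrite lee_fin.
      rewrite integral_density ?mule1; last by move=> i; rewrite mulr_ge0.
      over.
    rewrite sumEFin -mulr_sumr; over.
  rewrite sumEFin -mulr_sumr lee_fin mulrC ler_pdivrMr ?exprn_gt0//.
have := chi2_error_lb mF mz z0 z1 z2; apply/negP; rewrite -ltNge.
rewrite int_z; last exact: measurableC.
apply: (@le_lt_trans _ _ (alpha%:E + beta%:E)%E); last by rewrite -EFinD lte_fin; lra.
apply: leeD => //; rewrite -(sum_n beta) -sumEFin; apply: lee_sum => x _.
rewrite -FC EFinM lee_wpmul2l ?lee_fin ?invr_ge0 ?(ltW n0)//.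
by rewrite leNgt; apply/negP => /small.
Qed.

End testing.
End change_of_measure.

(** * Bounded measurable functions and step functions *)

Section bounded_measurable.
Context (R : realType).
Implicit Types (f g : R -> R).

(** A class stable under sums and products and contained in the integrable functions, which settles
    all integrability conditions below. *)
Definition bounded_mfun f : Prop :=
  measurable_fun [set: measurableTypeR R] (f : measurableTypeR R -> R) /\
  exists M, forall x, `|f x| <= M.

Lemma bounded_mfun_cst (a : R) : bounded_mfun (cst a).
Proof. by split; [exact: measurable_cst|exists `|a|]. Qed.

Lemma bounded_mfunD f g : bounded_mfun f -> bounded_mfun g ->
  bounded_mfun (fun x => f x + g x).
Proof.
move=> [mf [M fM]] [mg [M' gM]]; split; first exact: measurable_funD.
by exists (M + M') => x; rewrite (le_trans (ler_normD _ _))// lerD.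
Qed.

Lemma bounded_mfunM f g : bounded_mfun f -> bounded_mfun g ->
  bounded_mfun (fun x => f x * g x).
Proof.
move=> [mf [M fM]] [mg [M' gM]]; split; first exact: measurable_funM.
by exists (M * M') => x; rewrite normrM ler_pM.
Qed.

Lemma bounded_mfunZ (a : R) f : bounded_mfun f -> bounded_mfun (fun x => a * f x).
Proof. by move=> bf; exact: (bounded_mfunM (bounded_mfun_cst a) bf). Qed.

Lemma bounded_mfunB f g : bounded_mfun f -> bounded_mfun g ->
  bounded_mfun (fun x => f x - g x).
Proof.
move=> bf bg; have := bounded_mfunD bf (bounded_mfunZ (-1) bg).
by under eq_fun do rewrite mulN1r.
Qed.

Lemma bounded_mfun_sum (I : Type) (r : seq I) (F : I -> R -> R) :
  (forall i, bounded_mfun (F i)) -> bounded_mfun (fun x => \sum_(i <- r) F i x).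
Proof.
move=> bF; elim: r => [|i r IH].
  by under eq_fun do rewrite big_nil; exact: bounded_mfun_cst.
by under eq_fun do rewrite big_cons; exact: bounded_mfunD.
Qed.

Lemma bounded_mfun_indic (A : set (measurableTypeR R)) :
  measurable A -> bounded_mfun (\1_A : R -> R).
Proof.
move=> mA; split; first exact: measurable_indic.
by exists 1 => x; rewrite indicE; case: (_ \in _); rewrite ?normr1 ?normr0.
Qed.

Lemma bounded_mfun_integrable f : bounded_mfun f ->
  (leb01 R).-integrable setT (EFin \o f).
Proof.
move=> [mf [M fM]]; apply: measurable_bounded_integrable => //.
  exact: fin_num_fun_lty (fin_num_measure (leb01 R)) .
exists M; split; first exact: num_real.
by move=> y My x _ /=; rewrite (le_trans (fM x))// ltW.
Qed.

Lemma Rintegral_sum (I : Type) (r : seq I) (F : I -> R -> R) :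
  (forall i, bounded_mfun (F i)) ->
  \int[leb01 R]_x (\sum_(i <- r) F i x) = \sum_(i <- r) \int[leb01 R]_x F i x.
Proof.
move=> bF; elim: r => [|i r IH].
  by under eq_Rintegral do rewrite big_nil; rewrite Rintegral_cst// mul0r big_nil.
under eq_Rintegral do rewrite big_cons.
rewrite RintegralD ?big_cons ?IH//; first exact: bounded_mfun_integrable.
exact/bounded_mfun_integrable/bounded_mfun_sum.
Qed.

Lemma leb01E (A : set (measurableTypeR R)) :
  leb01 R A = lebesgue_measure (A `&` `[0, 1]).
Proof. by []. Qed.

Lemma Rintegral_indic (A : set (measurableTypeR R)) : measurable A ->
  \int[leb01 R]_x (\1_A x) = fine (leb01 R A).
Proof. by move=> mA; rewrite /Rintegral integral_indic// setIT. Qed.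

Section step_functions.
Context (I : finType) (c : measurableTypeR R -> I).
Hypothesis mc : forall i, measurable (c @^-1` [set i]).

Lemma step_indic (u : I -> R) x : u (c x) = \sum_i u i * \1_(c @^-1` [set i]) x.
Proof.
rewrite (bigD1 (c x))//= indicE mem_set// mulr1 big1 ?addr0// => i ic.
by rewrite indicE memNset ?mulr0//= => cx; rewrite cx eqxx in ic.
Qed.

Lemma bounded_mfun_step (u : I -> R) : bounded_mfun (u \o c).
Proof.
rewrite (_ : u \o c = fun x => \sum_i u i * \1_(c @^-1` [set i]) x).
  by apply: bounded_mfun_sum => i; apply/bounded_mfunZ/bounded_mfun_indic.
by apply/funext => x; exact: step_indic.
Qed.

Lemma Rintegral_step (u : I -> R) :
  \int[leb01 R]_x u (c x) = \sum_i fine (leb01 R (c @^-1` [set i])) * u i.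
Proof.
have bi i := bounded_mfun_indic (mc i).
under eq_Rintegral do rewrite step_indic.
rewrite Rintegral_sum => [|i]; last exact: bounded_mfunZ.
apply: eq_bigr => i _; rewrite RintegralZl//; last exact: bounded_mfun_integrable.
by rewrite Rintegral_indic// mulrC.
Qed.

End step_functions.

End bounded_measurable.

(** * Dyadic intervals and orthonormality of the Haar wavelets *)

Section dyadic.
Context (R : realType).

Definition dyadic (n k : nat) : set (measurableTypeR R) :=
  `[k%:R / 2 ^+ n, k.+1%:R / 2 ^+ n[%classic.

Lemma dyadicE n k x : dyadic n k x <-> k%:R <= 2 ^+ n * x < k.+1%:R.
Proof.
have p : (0 : R) < 2 ^+ n by rewrite exprn_gt0.
by rewrite /dyadic /= in_itv/= ler_pdivrMr// ltr_pdivlMr// mulrC.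
Qed.

Lemma measurable_dyadic n k : measurable (dyadic n k).
Proof. exact: measurable_itv. Qed.

Lemma bounded_mfun_dyadic n k : bounded_mfun (\1_(dyadic n k) : R -> R).
Proof. by apply: bounded_mfun_indic; exact: measurable_dyadic. Qed.

Lemma dyadic_inj n k k' x : dyadic n k x -> dyadic n k' x -> k = k'.
Proof.
move=> /dyadicE /andP[a b] /dyadicE /andP[a' b'].
have := le_lt_trans a b'; have := le_lt_trans a' b.
by rewrite !ltr_nat !ltnS => ? ?; apply/eqP; rewrite eqn_leq; apply/andP.
Qed.

Lemma dyadic_coarser n m k x : dyadic (n + m) k x -> dyadic n (k %/ 2 ^ m) x.
Proof.
have p : (0 : R) < 2 ^+ m by rewrite exprn_gt0.
move=> /dyadicE; rewrite exprD => /andP[a b]; apply/dyadicE/andP; split.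
  rewrite -(ler_pM2r p) mulrAC (le_trans _ a)// -natrX -natrM ler_nat.
  exact: leq_divM.
rewrite -(ltr_pM2r p) mulrAC (lt_le_trans b)// -natrX -natrM ler_nat.
by rewrite ltn_ceil// expn_gt0.
Qed.

Lemma leb01_dyadic n k : (k < 2 ^ n)%N -> fine (leb01 R (dyadic n k)) = 2 ^- n.
Proof.
move=> kn; have p : (0 : R) < 2 ^+ n by rewrite exprn_gt0.
have lt : k%:R / 2 ^+ n < k.+1%:R / 2 ^+ n :> R.
  by rewrite ltr_pM2r ?invr_gt0// ltr_nat.
rewrite leb01E setIidl; last first.
  move=> x /dyadicE /andP[a b]; rewrite /= in_itv/=; apply/andP; split.
    by rewrite -(pmulr_rge0 _ p) (le_trans _ a).
  by rewrite -(ler_pM2l p) mulr1 (le_trans (ltW b))// -natrX ler_nat.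
rewrite /dyadic lebesgue_measure_itv/= lte_fin lt -EFinB/=.
by rewrite -mulrBl -natr1 addrC addKr mul1r.
Qed.

Lemma eq_indic (T T' : Type) (A : set T) (B : set T') x y :
  (A x <-> B y) -> \1_A x = \1_B y :> R.
Proof.
move=> AB; rewrite !indicE; have [Ax|nAx] := pselect (A x).
  by rewrite !mem_set//; exact/AB.
by rewrite !memNset//; rewrite -AB.
Qed.

(** A wavelet is a difference of indicators of two sibling dyadic intervals of the next level, so
    its inner products reduce to those of dyadic indicators. *)
Lemma haarE j k x :
  haar j k x = 2 `^ (j%:R / 2) *
    (\1_(dyadic j.+1 k.*2) x - \1_(dyadic j.+1 k.*2.+1) x) :> R.
Proof.
have e0 : k.*2%:R = 2 * k%:R :> R by rewrite -mul2n natrM.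
have e1 : k.*2.+1%:R = 2 * k%:R + 1 :> R by rewrite -natr1 e0.
have e2 : k.*2.+2%:R = 2 * k%:R + 1 + 1 :> R by rewrite -natr1 e1.
rewrite /haar /haar_psi; congr (_ * (_ - _)); apply: eq_indic;
  rewrite dyadicE /= in_itv/= exprS ?e0 ?e1 ?e2 -mulrA;
  by split=> /andP[a b]; apply/andP; split; lra.
Qed.

Lemma bounded_mfun_haar j k : bounded_mfun (haar j k : R -> R).
Proof.
rewrite (funext (haarE j k)); apply: bounded_mfunZ.
by apply: bounded_mfunB; exact: bounded_mfun_dyadic.
Qed.

Definition dyadic_gram n k n' k' : R :=
  \int[leb01 R]_x (\1_(dyadic n k) x * \1_(dyadic n' k') x).

(** Dyadic intervals are nested or disjoint: the product of the indicators is the finer one when the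
    coarser interval is its ancestor, and zero otherwise. *)
Lemma dyadic_gramE n m k k' : (k' < 2 ^ (n + m))%N ->
  dyadic_gram n k (n + m) k' = 2 ^- (n + m) * (k == k' %/ 2 ^ m)%N%:R.
Proof.
move=> kn; rewrite /dyadic_gram.
have E x : \1_(dyadic n k) x * \1_(dyadic (n + m) k') x =
    (k == k' %/ 2 ^ m)%N%:R * \1_(dyadic (n + m) k') x :> R.
  rewrite !indicE; have [/set_mem|] := boolP (x \in dyadic (n + m) k'); last first.
    by rewrite !mulr0.
  move=> /dyadic_coarser xm; rewrite !mulr1; congr (_%:R).
  case: eqP => [->|kk]; first by rewrite mem_set.
  by rewrite memNset// => /dyadic_inj /(_ xm).
under eq_Rintegral do rewrite E.
rewrite RintegralZl//; last first.
  exact: bounded_mfun_integrable (bounded_mfun_dyadic _ _).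
by rewrite (Rintegral_indic (measurable_dyadic _ _)) leb01_dyadic// mulrC.
Qed.

Lemma inner01C f g : inner01 f g = inner01 g f :> R.
Proof.
by congr Rintegral; apply: funext => x; rewrite mulrC.
Qed.

Lemma inner01Zl a f g : bounded_mfun f -> bounded_mfun g ->
  inner01 (fun x => a * f x) g = a * inner01 f g :> R.
Proof.
move=> bf bg; rewrite /inner01; under eq_Rintegral do rewrite -mulrA.
by rewrite RintegralZl//; exact/bounded_mfun_integrable/bounded_mfunM.
Qed.

Lemma inner01Dl f1 f2 g : bounded_mfun f1 -> bounded_mfun f2 -> bounded_mfun g ->
  inner01 (fun x => f1 x + f2 x) g = inner01 f1 g + inner01 f2 g :> R.
Proof.
move=> b1 b2 bg; rewrite /inner01; under eq_Rintegral do rewrite mulrDl.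
by rewrite RintegralD//; exact/bounded_mfun_integrable/bounded_mfunM.
Qed.

Lemma inner01Bl f1 f2 g : bounded_mfun f1 -> bounded_mfun f2 -> bounded_mfun g ->
  inner01 (fun x => f1 x - f2 x) g = inner01 f1 g - inner01 f2 g :> R.
Proof.
move=> b1 b2 bg; rewrite /inner01; under eq_Rintegral do rewrite mulrBl.
by rewrite RintegralB//; exact/bounded_mfun_integrable/bounded_mfunM.
Qed.

Lemma inner01_sqrD f g : bounded_mfun f -> bounded_mfun g ->
  inner01 (fun x => f x + g x) (fun x => f x + g x)
  = inner01 f f + 2 * inner01 f g + inner01 g g :> R.
Proof.
move=> bf bg; have bfg := bounded_mfunD bf bg.
rewrite inner01Dl// (inner01C f) (inner01C g) !inner01Dl// (inner01C g f); ring.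
Qed.

Lemma inner01_suml (I : finType) (F : I -> R -> R) g :
  (forall i, bounded_mfun (F i)) -> bounded_mfun g ->
  inner01 (fun x => \sum_i F i x) g = \sum_i inner01 (F i) g :> R.
Proof.
move=> bF bg; rewrite /inner01; under eq_Rintegral do rewrite mulr_suml.
by rewrite Rintegral_sum// => i; exact: bounded_mfunM.
Qed.

Lemma inner01_haar_dyadic j k n l :
  inner01 (haar j k) (\1_(dyadic n l)) =
  2 `^ (j%:R / 2) * (dyadic_gram j.+1 k.*2 n l - dyadic_gram j.+1 k.*2.+1 n l).
Proof.
have bd := bounded_mfun_dyadic.
by rewrite (funext (haarE j k)) inner01Zl ?inner01Bl//; exact: bounded_mfunB.
Qed.

Lemma pow2_half_sqr (j : nat) : 2 `^ (j%:R / 2) * 2 `^ (j%:R / 2) = 2 ^+ j :> R.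
Proof.
rewrite -powRD; last by rewrite pnatr_eq0 implybT.
by rewrite -powR_mulrn//; congr (_ `^ _); field.
Qed.

(** On equal levels only identical halves meet. On different levels both halves of the finer wavelet
    have the same ancestor at level [j.+1], where the coarser wavelet is constant, so their
    contributions cancel. *)
Lemma inner01_haar j k j' k' : (k < 2 ^ j)%N -> (k' < 2 ^ j')%N ->
  inner01 (haar j k) (haar j' k') = ((j == j') && (k == k'))%:R :> R.
Proof.
wlog jj : j k j' k' / (j <= j')%N.
  move=> H kj kj'; have [jj|/ltnW jj] := leqP j j'; first exact: H.
  by rewrite inner01C H// eq_sym (eq_sym k).
move=> kj kj'.
have bd := bounded_mfun_dyadic.
rewrite inner01C (funext (haarE j' k')).
have bh := bounded_mfun_haar j k.
rewrite inner01Zl ?inner01Bl//; last exact: bounded_mfunB.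
rewrite !(inner01C _ (haar j k)) !inner01_haar_dyadic -(subnKC jj).
set m := (j' - j)%N; rewrite -addSn.
have l1 : (k'.*2 < 2 ^ (j.+1 + m))%N by rewrite addSn subnKC// expnS; lia.
have l2 : (k'.*2.+1 < 2 ^ (j.+1 + m))%N by rewrite addSn subnKC// expnS; lia.
rewrite !dyadic_gramE//; case: (posnP m) => [->|m0].
  rewrite !addn0 expn0 !divn1 eqxx/= eqSS.
  have -> : (k.*2 == k'.*2) = (k == k') by lia.
  have -> : (k.*2 == k'.*2.+1) = false by lia.
  have -> : (k.*2.+1 == k'.*2) = false by lia.
  set e := (k == k')%:R; rewrite !mulr0 subr0 sub0r mulrN opprK -mulrDr.
  rewrite mulrA pow2_half_sqr exprS invfM -mulrDl.
  have p : (2 : R) ^+ j != 0 by rewrite expf_neq0.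
  by field.
have -> : (k'.*2 %/ 2 ^ m = k'.*2.+1 %/ 2 ^ m)%N.
  rewrite -(prednK m0) expnS !divnMA.
  by congr (_ %/ _)%N; lia.
rewrite subrr mulr0; have -> : (j == j + m)%N = false by lia.
by [].
Qed.

End dyadic.

(** * Reduction of Haar functions to finitely many cells *)

Section cells.
Context (R : realType) (n : nat).

(* The cell None collects the points outside [0, 1[; its representative is 2. *)
Definition cell (x : measurableTypeR R) : option 'I_(2 ^ n) :=
  [pick i : 'I_(2 ^ n) | `[< dyadic n i x >]].

Definition cell_point (o : option 'I_(2 ^ n)) : R :=
  if o is Some i then i%:R / 2 ^+ n else 2.

Lemma cellP x (o : option 'I_(2 ^ n)) : cell x = o ->
  if o is Some i then dyadic n i x else forall k, (k < 2 ^ n)%N -> ~ dyadic n k x.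
Proof.
rewrite /cell; case: pickP => [i /asboolP xi <-//|H <- k kn xk].
by have /asboolP := H (Ordinal kn).
Qed.

Lemma cell_Some x (i : 'I_(2 ^ n)) : dyadic n i x -> cell x = Some i.
Proof.
move=> xi; case E : (cell x) (cellP (erefl (cell x))) => [j|] /=.
  by move=> /dyadic_inj /(_ xi) ji; congr Some; exact/val_inj.
by move=> /(_ i (ltn_ord i)).
Qed.

(** This makes any function built from the dyadic intervals of level [n] in the unit interval a step
    function on the cells. *)
Lemma dyadic_cell_point x k : (k < 2 ^ n)%N ->
  dyadic n k x <-> dyadic n k (cell_point (cell x)).
Proof.
move=> kn; have p : (0 : R) < 2 ^+ n by rewrite exprn_gt0.
case E : (cell x) (cellP (erefl (cell x))) => [i|] /=.
  move=> xi; have ii : dyadic n i (i%:R / 2 ^+ n : R).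
    by apply/dyadicE; rewrite mulrC divfK ?gt_eqF// lexx/= ltr_nat.
  split=> [xk|ik]; first by rewrite -(dyadic_inj xi xk).
  by rewrite -(dyadic_inj ii ik).
move=> xn; split=> [/xn|/dyadicE /andP[_]]; first by move/(_ kn).
(* The representative 2 would need [2 ^ n * 2 < k.+1], which [k < 2 ^ n] excludes. *)
rewrite -natrX -natrM ltr_nat => /(leq_trans)/(_ kn); lia.
Qed.

Lemma measurable_cell o : measurable (cell @^-1` [set o]).
Proof.
have mS i : measurable (cell @^-1` [set Some i]).
  have -> : cell @^-1` [set Some i] = dyadic n i; last exact: measurable_dyadic.
  by apply/seteqP; split => x /=; [move/cellP|move/cell_Some].
case: o => [i|]; first exact: mS.
have -> : cell @^-1` [set None]
    = ~` \bigcup_(i in [set: 'I_(2 ^ n)]) cell @^-1` [set Some i].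
  apply/seteqP; split => x /=; first by move=> xN [i _ /=]; rewrite xN.
  by case E : (cell x) => [i|]// []; exists i.
by apply/measurableC/fin_bigcup_measurable => // i _; exact: mS.
Qed.

End cells.

Lemma haar_cell_point (R : realType) j k (x : measurableTypeR R) : (k < 2 ^ j)%N ->
  haar j k x = haar j k (cell_point R (cell j.+1 x)) :> R.
Proof.
move=> kj; rewrite !haarE; congr (_ * (_ - _)); apply: eq_indic;
  by apply: dyadic_cell_point; rewrite expnS; lia.
Qed.

Lemma norm_haar (R : realType) j k x :
  `|haar j k x| <= 2 `^ (j%:R / 2) * \1_(dyadic j k) x :> R.
Proof.
rewrite haarE normrM ger0_norm ?powR_ge0// ler_wpM2l ?powR_ge0// !indicE.
have sub l : (l %/ 2 = k)%N -> dyadic j.+1 l x -> dyadic j k x.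
  by move=> <-; rewrite -addn1 => /dyadic_coarser; rewrite expn1.
have [/set_mem x0|_] := boolP (x \in dyadic j.+1 k.*2).
  have xk : dyadic j k x by apply: sub x0; lia.
  rewrite (memNset (A := dyadic j.+1 k.*2.+1)) ?(mem_set xk) ?subr0 ?normr1//.
  by move=> /(dyadic_inj x0); lia.
rewrite sub0r normrN; have [/set_mem x1|_] := boolP (x \in dyadic j.+1 k.*2.+1).
  have xk : dyadic j k x by apply: sub x1; lia.
  by rewrite mem_set ?normr1.
by rewrite normr0.
Qed.

Lemma norm01E (R : realType) (f : R -> R) : bounded_mfun f ->
  norm01 f = (Num.sqrt (inner01 f f))%:E.
Proof.
move=> bf; rewrite /norm01 unlock /Lnorm.
have -> : (\int[leb01 R]_x (`|(EFin \o f) x| `^ 2) = (inner01 f f)%:E)%E.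
  rewrite /inner01 /Rintegral fineK; last first.
    by apply: integrable_fin_num => //; exact/bounded_mfun_integrable/bounded_mfunM.
  apply: eq_integral => x _ /=; congr EFin.
  by rewrite powR_mulrn// expr2 -normrM ger0_norm// -expr2 sqr_ge0.
rewrite poweR_EFin powR12_sqrt//.
by apply: Rintegral_ge0 => x _; rewrite -expr2 sqr_ge0.
Qed.

Lemma bounded_mfun_intensity (R : realType) (f : R -> R) : bounded_mfun f ->
  (forall x, 0 <= f x) -> intensity f.
Proof.
move=> bf f0; split => [|x _]; last exact: f0.
rewrite inE; apply/andP; split; first by rewrite inE; exact: bf.1.
rewrite inE /= /finite_norm; have := norm01E bf; rewrite /norm01 => ->.
exact: ltry.
Qed.

Lemma inner01_haar_cst (R : realType) j k : (k < 2 ^ j)%N ->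
  inner01 (haar j k) (cst 1) = 0 :> R.
Proof.
move=> kj; have bd := @bounded_mfun_dyadic R; have b1 := bounded_mfun_cst (1 : R).
have W l : (l < 2 ^ j.+1)%N -> inner01 (\1_(dyadic j.+1 l)) (cst 1) = 2 ^- j.+1 :> R.
  move=> lj; rewrite /inner01; under eq_Rintegral do rewrite mulr1.
  by rewrite (Rintegral_indic (measurable_dyadic _ _)) leb01_dyadic.
rewrite (funext (haarE j k)) inner01Zl ?inner01Bl//; last exact: bounded_mfunB.
by rewrite !W ?subrr ?mulr0// expnS; lia.
Qed.

(** * Perturbations of the constant intensity and the function classes *)

Section bump.
Context (R : realType) (J m : nat).
Implicit Types (K : 'I_m -> nat) (sg : 'I_m -> R) (a : R).

Definition wave a K sg (x : R) : R := \sum_b a * sg b * haar J (K b) x.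

Lemma bounded_mfun_wave a K sg : bounded_mfun (wave a K sg).
Proof.
by apply: bounded_mfun_sum => b; apply: bounded_mfunZ; exact: bounded_mfun_haar.
Qed.

Lemma wave_cell_point a K sg (x : measurableTypeR R) : (forall b, K b < 2 ^ J)%N ->
  wave a K sg x = wave a K sg (cell_point R (cell J.+1 x)).
Proof. by move=> KJ; apply: eq_bigr => b _; rewrite -haar_cell_point. Qed.

Lemma inner01_wavel a K sg f : bounded_mfun f ->
  inner01 (wave a K sg) f = \sum_b a * sg b * inner01 (haar J (K b)) f.
Proof.
move=> bf; have bh b := bounded_mfun_haar R J (K b).
rewrite inner01_suml//; last by move=> b; exact: bounded_mfunZ.
by apply: eq_bigr => b _; rewrite inner01Zl.
Qed.

Lemma inner01_wave_cst a K sg : (forall b, K b < 2 ^ J)%N ->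
  inner01 (wave a K sg) (cst 1) = 0.
Proof.
move=> KJ; rewrite inner01_wavel ?big1//; last exact: bounded_mfun_cst.
by move=> b _; rewrite inner01_haar_cst// mulr0.
Qed.

Lemma inner01_wave_haar a K sg j k : (forall b, K b < 2 ^ J)%N -> (k < 2 ^ j)%N ->
  inner01 (wave a K sg) (haar j k)
  = a * \sum_b sg b * ((J == j) && (K b == k))%:R.
Proof.
move=> KJ kj; rewrite inner01_wavel; last exact: bounded_mfun_haar.
by rewrite mulr_sumr; apply: eq_bigr => b _; rewrite inner01_haar// mulrA.
Qed.

Lemma inner01_wave a K sg K' sg' :
  (forall b, K b < 2 ^ J)%N -> (forall b, K' b < 2 ^ J)%N ->
  inner01 (wave a K sg) (wave a K' sg')
  = a ^+ 2 * \sum_b \sum_b' sg b * sg' b' * (K b == K' b')%:R.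
Proof.
move=> KJ KJ'; rewrite inner01_wavel; last exact: bounded_mfun_wave.
rewrite mulr_sumr; apply: eq_bigr => b _.
rewrite inner01C inner01_wave_haar// !mulr_sumr.
by apply: eq_bigr => b' _; rewrite eqxx/= (eq_sym (K' _)); ring.
Qed.

Section signs.
Context (a : R) (K : 'I_m -> nat) (sg : 'I_m -> R).
Hypotheses (a0 : 0 <= a) (Kinj : injective K) (KJ : (forall b, K b < 2 ^ J)%N).
Hypothesis sg2 : forall b, sg b ^+ 2 = 1.

Lemma inner01_wave_self : inner01 (wave a K sg) (wave a K sg) = a ^+ 2 * m%:R.
Proof.
rewrite inner01_wave//; congr (_ * _).
rewrite (eq_bigr (fun=> 1)); last first.
  move=> b _; rewrite (bigD1 b)//= eqxx mulr1 -expr2 sg2 big1 ?addr0// => b' bb'.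
  by rewrite (inj_eq Kinj) eq_sym (negbTE bb') mulr0.
by rewrite sumr_const card_ord.
Qed.

(** Wavelets of one level have disjoint supports, so at most one term is nonzero at each point. *)
Lemma norm_wave x : `|wave a K sg x| <= a * 2 `^ (J%:R / 2).
Proof.
have nsg b : `|sg b| = 1.
  by apply/eqP; rewrite -(@eqrXn2 _ 2) ?normr_ge0// -normrX sg2 normr1 expr1n.
rewrite (le_trans (ler_norm_sum _ _ _))//.
apply: (@le_trans _ _ (\sum_b (a * 2 `^ (J%:R / 2)) * \1_(dyadic J (K b)) x)).
  apply: ler_sum => b _; rewrite 2!normrM nsg mulr1 ger0_norm// -mulrA.
  by apply: ler_wpM2l => //; exact: norm_haar.
rewrite -mulr_sumr ler_piMr ?mulr_ge0 ?powR_ge0//.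
have [[b xb]|nb] := pselect (exists b, dyadic J (K b) x); last first.
  by rewrite big1// => b _; rewrite indicE memNset//= => xb; apply: nb; exists b.
rewrite (bigD1 b)//= indicE mem_set// big1 ?addr0// => b' bb'.
rewrite indicE memNset//= => /(dyadic_inj xb) /Kinj bE.
by rewrite bE eqxx in bb'.
Qed.

Definition bump x := 1 + wave a K sg x.

Lemma bounded_mfun_bump : bounded_mfun bump.
Proof.
exact: bounded_mfunD (bounded_mfun_cst 1) (bounded_mfun_wave _ _ _).
Qed.

(** The constant 1 is orthogonal to all wavelets and [K] is injective, so at most one [b]
    contributes. Squaring removes its sign. *)
Lemma bump_haar_coef j k : (k < 2 ^ j)%N ->
  haar_coef bump j k ^+ 2 = a ^+ 2 * \sum_b ((J == j) && (K b == k))%:R.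
Proof.
move=> kj; have b1 := bounded_mfun_cst (1 : R).
rewrite /haar_coef (@inner01Dl _ (cst 1))//; last 2 first.
- exact: bounded_mfun_wave.
- exact: bounded_mfun_haar.
rewrite inner01C inner01_haar_cst// add0r inner01_wave_haar// exprMn; congr (_ * _).
have [[b bk]|nb] := pselect (exists b, (J == j) && (K b == k)); last first.
  have nb' b : (J == j) && (K b == k) = false.
    by apply/negP => bk; apply: nb; exists b.
  by rewrite !big1 ?expr0n// => b _; rewrite nb' ?mulr0.
have nb' b' : b' != b -> (J == j) && (K b' == k) = false.
  move: bk => /andP[-> /eqP <-] /= bb'; rewrite (inj_eq Kinj).
  exact/negbTE.
rewrite (bigD1 b)//= bk mulr1 big1 ?addr0; last by move=> b' /nb' ->; rewrite mulr0.
by rewrite (bigD1 b)//= bk big1 ?addr0// => b' /nb' ->.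
Qed.

Lemma bump_haar_energy j :
  \sum_(k < 2 ^ j) haar_coef bump j k ^+ 2 = (J == j)%:R * (a ^+ 2 * m%:R).
Proof.
under eq_bigr => k _ do rewrite bump_haar_coef//.
rewrite -mulr_sumr exchange_big mulrCA; congr (_ * _).
case: eqP => [<-|_] /=; last first.
  by rewrite mul0r big1// => b _; rewrite big1.
rewrite mul1r (eq_bigr (fun=> 1)) ?sumr_const ?card_ord// => b _.
rewrite (bigD1 (Ordinal (KJ b)))//= eqxx big1 ?addr0// => k kb.
by case: eqP => // bk; move: kb; rewrite -(inj_eq val_inj)/= bk eqxx.
Qed.

Hypothesis bound : a * 2 `^ (J%:R / 2) <= 1.

Lemma bump_ge0 x : 0 <= bump x.
Proof.
have := le_trans (norm_wave x) bound; rewrite ler_norml /bump => /andP[]; lra.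
Qed.

Lemma bump_le2 x : `|bump x| <= 2.
Proof.
have := le_trans (norm_wave x) bound; rewrite ler_norml /bump => /andP[? ?].
by rewrite ler_norml; lra.
Qed.

Lemma intensity_bump : intensity bump.
Proof. exact: bounded_mfun_intensity bounded_mfun_bump bump_ge0. Qed.

(** Pythagoras: subtracting a constant [t] leaves [1 - t] plus the wave, which is orthogonal to
    constants. *)
Lemma dist01_bump : ((Num.sqrt (a ^+ 2 * m%:R))%:E <= dist01 bump (@constant_funs R))%E.
Proof.
apply: le_ereal_inf_tmp => _ [_ [t _ <-] <-].
have b1 := bounded_mfun_cst (1 - t : R); have bw := bounded_mfun_wave a K sg.
have -> : bump \- cst t = (fun x : R => cst (1 - t) x + wave a K sg x).
  by apply/funext => x; rewrite /bump /=; ring.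
have bE := bounded_mfunD b1 bw.
have wave1 : inner01 (wave a K sg) (cst (1 - t)) = 0.
  have -> : cst (1 - t) = (fun x : R => (1 - t) * cst 1 x : R).
    by apply/funext => x /=; ring.
  rewrite inner01C inner01Zl//; last exact: bounded_mfun_cst.
  by rewrite (inner01C (cst 1)) inner01_wave_cst// mulr0.
rewrite norm01E// lee_fin ler_wsqrtr//.
rewrite inner01_sqrD// (inner01C _ (wave _ _ _)) wave1 mulr0 addr0 inner01_wave_self.
by rewrite lerDr; apply: Rintegral_ge0 => x _; rewrite -expr2 sqr_ge0.
Qed.

End signs.
End bump.

Lemma nneseries_single_le (R : realType) (f : nat -> R) (J : nat) (C : R) :
  (forall j, 0 <= f j <= (J == j)%:R * C) -> 0 <= C ->
  (\sum_(0 <= j <oo) (f j)%:E <= C%:E)%E.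
Proof.
move=> fC C0; apply: lime_le.
  by apply: is_cvg_nneseries => j _ _; rewrite lee_fin; case/andP: (fC j).
apply: nearW => n; rewrite big_mkord sumEFin lee_fin.
apply: (@le_trans _ _ (\sum_(j < n) (J == j)%:R * C)).
  by apply: ler_sum => j _; case/andP: (fC j).
rewrite -mulr_suml ler_piMl//.
have [Jn|nJ] := ltnP J n; last first.
  by rewrite big1// => j _; case: eqP => // Jj; move: (ltn_ord j); rewrite -Jj ltnNge nJ.
rewrite (bigD1 (Ordinal Jn))//= eqxx big1 ?addr0// => j jJ.
by case: eqP => // Jj; move: jJ; rewrite -(inj_eq val_inj)/= Jj eqxx.
Qed.

(** All the energy sits at level [J], so the Besov condition matters only there. Every nonzero
    squared coefficient is [a ^+ 2]: the weak Besov sum vanishes for smaller [t], and beyond that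
    value its bound increases with [t], so [t = a ^+ 2] is the critical case. *)
Lemma bump_in_classes (R : realType) (J m : nat) (a : R) (K : 'I_m -> nat)
    (sg : 'I_m -> R) (delta gamma r r' r'' : R) :
  0 <= a -> injective K -> (forall b, K b < 2 ^ J)%N -> (forall b, sg b ^+ 2 = 1) ->
  0 < gamma -> 2 <= r'' -> a * 2 `^ (J%:R / 2) <= 1 ->
  a ^+ 2 * m%:R <= r ^+ 2 * 2 `^ (- (2 * J%:R * delta)) ->
  a ^+ 2 * m%:R <= r' ^+ 2 * (a ^+ 2) `^ (2 * gamma / (1 + 2 * gamma)) ->
  (besov_body delta r `&` weak_besov_body gamma r' `&` bounded_by r'') (bump J a K sg).
Proof.
move=> a0 Kinj KJ sg2 g0 r2 bound besov weak.
have sI := intensity_bump a0 Kinj sg2 bound.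
split; first split.
- split=> // j; rewrite bump_haar_energy//; case: eqP => [<-|_].
    by rewrite mul1r.
  by rewrite mul0r; apply: mulr_ge0; [exact: sqr_ge0|exact: powR_ge0].
- split=> // t t0; have [ta|at_] := ltP t (a ^+ 2).
    rewrite eseries0 => [|j _ _].
      by rewrite lee_fin; apply: mulr_ge0; [exact: sqr_ge0|exact: powR_ge0].
    congr EFin; apply: big1 => k _; rewrite bump_haar_coef//.
    rewrite -natr_sum; set n := (\sum_b _)%N; case: n => [|n].
      by rewrite mulr0 mul0r.
    rewrite leNgt (lt_le_trans ta) ?mulr0//.
    by rewrite ler_peMr ?sqr_ge0// ler1n.
  apply: (@le_trans _ _ (a ^+ 2 * m%:R)%:E).
    apply: (@nneseries_single_le _ _ J) => [j|]; last by rewrite mulr_ge0 ?sqr_ge0.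
    rewrite -(bump_haar_energy a Kinj KJ sg2); apply/andP; split.
      by apply: sumr_ge0 => k _; rewrite mulr_ge0 ?sqr_ge0.
    by apply: ler_sum => k _; rewrite ler_piMr ?sqr_ge0//; case: (_ <= t).
  rewrite lee_fin (le_trans weak)// ler_wpM2l ?sqr_ge0//.
  rewrite ge0_ler_powR ?nnegrE ?sqr_ge0 ?(ltW t0)//.
  by rewrite divr_ge0 ?mulr_ge0 ?addr_ge0 ?mulr_ge0 ?ltW.
- by move=> x _; rewrite (le_trans (bump_le2 a0 Kinj sg2 bound x)).
Qed.

(** * Second moment of the prior *)

(** The left side equals [(1 - expR (- u)) ^+ 2 * expR u], with [1 - expR (- u)] between 0 and [u].
    The bound serves both bounded [u] and [u] growing like a logarithm. *)
Lemma expRD_expRN_le (R : realType) (u : R) : 0 <= u ->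
  expR u + expR (- u) - 2 <= u ^+ 2 * expR u.
Proof.
move=> u0; have E0 := expR_gt0 u; have V0 := expR_gt0 (- u).
have EV : expR u * expR (- u) = 1 by rewrite expRN divff ?gt_eqF.
have H1 := expR_ge1Dx (- u).
have H2 : expR (- u) <= 1 by rewrite -expR0 ler_expR oppr_le0.
have -> : expR u + expR (- u) - 2 = (1 - expR (- u)) ^+ 2 * expR u.
  have -> : (1 - expR (- u)) ^+ 2 * expR u =
    expR u - 2 * (expR u * expR (- u)) + (expR u * expR (- u)) * expR (- u) by ring.
  by rewrite EV; ring.
by rewrite ler_wpM2r ?(ltW E0)// ler_sqr ?nnegrE; lra.
Qed.

Section prior.
Context (R : realType) (p q : nat).
Implicit Types f g : {ffun 'I_(2 ^ p) -> 'I_(2 ^ q) * bool}.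

Definition prior_index f (b : 'I_(2 ^ p)) : nat := (b * 2 ^ q + (f b).1)%N.
Definition prior_sign f (b : 'I_(2 ^ p)) : R := (-1) ^+ (f b).2.

Lemma prior_index_eq f g b b' :
  (prior_index f b == prior_index g b') = (b == b') && ((f b).1 == (g b).1).
Proof.
apply/eqP/idP => [|/andP[/eqP <- /eqP fg]]; last by rewrite /prior_index fg.
rewrite /prior_index => E.
have q0 : (0 < 2 ^ q)%N by rewrite expn_gt0.
have bb' : b = b'.
  apply/val_inj; have := congr1 (divn ^~ (2 ^ q)%N) E.
  by rewrite /= !divnMDl// !divn_small ?ltn_ord// !addn0.
move: E; rewrite -bb' => /addnI fg; rewrite eqxx/=; exact/eqP/val_inj.
Qed.

Lemma prior_index_inj f : injective (prior_index f).
Proof. by move=> b b' /eqP; rewrite prior_index_eq => /andP[/eqP]. Qed.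

Lemma prior_index_lt f b : (prior_index f b < 2 ^ (p + q))%N.
Proof.
rewrite /prior_index expnD; apply: (@leq_trans (b.+1 * 2 ^ q)%N).
  by rewrite mulSn addnC ltn_add2r ltn_ord.
by rewrite leq_mul2r ltn_ord orbT.
Qed.

Lemma prior_sign_sqr f b : prior_sign f b ^+ 2 = 1.
Proof. by rewrite /prior_sign sqrr_sign. Qed.

(** Wavelets from different blocks never coincide, so only the diagonal terms survive. *)
Lemma prior_overlap f g :
  \sum_b \sum_b' prior_sign f b * prior_sign g b'
     * (prior_index f b == prior_index g b')%:R
  = \sum_b prior_sign f b * prior_sign g b * ((f b).1 == (g b).1)%:R.
Proof.
apply: eq_bigr => b _; rewrite (bigD1 b)//= prior_index_eq eqxx/= big1 ?addr0//.
by move=> b' bb'; rewrite prior_index_eq eq_sym (negbTE bb') mulr0.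
Qed.

(** The exponential of a sum over blocks is a product, and the sum over [g] distributes over it. In
    each block the [2 * (2 ^ q - 1)] choices missing the wavelet of [f] contribute 1 each, and the
    two signs on that wavelet give [expR u + expR (- u)]. *)
Lemma prior_chi2 (u : R) f :
  \sum_g expR (u * \sum_b prior_sign f b * prior_sign g b * ((f b).1 == (g b).1)%:R)
  = ((2 ^ q).*2%:R + (expR u + expR (- u) - 2)) ^+ (2 ^ p).
Proof.
under eq_bigr do rewrite mulr_sumr expR_sum.
rewrite -(bigA_distr_bigA (fun b (t : 'I_(2 ^ q) * bool) =>
  expR (u * ((-1) ^+ (f b).2 * (-1) ^+ t.2 * ((f b).1 == t.1)%:R)))).
rewrite -[X in _ ^+ X]card_ord -prodr_const; apply: eq_bigr => b _.
case: (f b) => k s /=.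
rewrite -(pair_bigA _ (fun (i : 'I_(2 ^ q)) (e : bool) =>
  expR (u * ((-1) ^+ s * (-1) ^+ e * (k == i)%:R))))/=.
rewrite (bigD1 k)//= eqxx !big_bool/= !mulr1 (eq_bigr (fun=> 2)); last first.
  by move=> i ik; rewrite big_bool eq_sym (negbTE ik) !mulr0 expR0.
rewrite sumr_const cardC1 card_ord.
have -> : expR (u * ((-1) ^+ s * -1)) + expR (u * (-1) ^+ s) = expR u + expR (- u).
  by case: s => /=; rewrite ?expr1 ?expr0 ?mulrN1 ?mulN1r ?mul1r ?opprK ?mulr1// addrC.
have q0 : (0 < 2 ^ q)%N by rewrite expn_gt0.
have E : (2 ^ q)%:R = (2 ^ q).-1%:R + 1 :> R by rewrite natr1 prednK.
rewrite -(mulr_natr 2 (2 ^ q).-1) -mul2n natrM E; ring.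
Qed.

End prior.

(** Factoring out [D] and using [1 + y <= expR y] leaves an exponential of at most 1/8, and
    [expR (1 / 8) <= 8 / 7 <= 29 / 25]. *)
Lemma prior_chi2_le (R : realType) (p q : nat) (u : R) : 0 <= u ->
  (2 ^ p)%:R / (2 * (2 ^ q)%:R) * (u ^+ 2 * expR u) <= 1 / 8 ->
  ((2 ^ q).*2%:R + (expR u + expR (- u) - 2)) ^+ (2 ^ p)
  <= 29 / 25 * (2 ^ q).*2%:R ^+ (2 ^ p).
Proof.
move=> u0 small; set m := (2 ^ p)%N in small *.
set D : R := (2 ^ q).*2%:R.
have D0 : 0 < D by rewrite ltr0n double_gt0 expn_gt0.
have DE : 2 * (2 ^ q)%:R = D by rewrite /D -mul2n natrM.
set h := expR u + expR (- u) - 2.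
have h0 : 0 <= h.
  rewrite /h; have := expR_ge1Dx u; have := expR_ge1Dx (- u); lra.
have hD : 0 <= h / D by rewrite divr_ge0// ltW.
have -> : D + h = D * (1 + h / D) by field; rewrite gt_eqF.
rewrite exprMn mulrC ler_wpM2r ?exprn_ge0 ?(ltW D0)//.
apply: (@le_trans _ _ (expR (h / D) ^+ m)).
  by rewrite lerXn2r ?nnegrE ?expR_ge0 ?expR_ge1Dx// addr_ge0.
have mh : h / D *+ m <= 1 / 8.
  apply: le_trans small; rewrite DE -mulr_natr mulrAC -mulrA [leLHS]mulrC.
  by apply: ler_wpM2l (expRD_expRN_le u0); rewrite divr_ge0// ltW.
rewrite -expRM_natl -(mulr_natl _ m) in mh *.
apply: (@le_trans _ _ (expR (1 / 8))); first by rewrite ler_expR.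
have EV : expR (1 / 8 : R) * expR (- (1 / 8)) = 1 by rewrite expRN divff ?gt_eqF ?expR_gt0.
have V : 7 / 8 <= expR (- (1 / 8)) :> R by have := expR_ge1Dx (- (1 / 8) : R); lra.
have E0 := expR_gt0 (1 / 8 : R); nra.
Qed.

(** * From the prior to the minimax separation rate *)

Section minimax.
Context (R : realType) (d : measure_display) (Omega : measurableType d)
  (N : R.-ker Omega ~> measurableTypeR R)
  (P : R -> (R -> R) -> probability Omega R)
  (hP : forall (L : R) (s : R -> R), 0 < L -> intensity s ->
            poisson_process (P L s) N (mean_measure L s)).

(** If a level [alpha] test separated at some [rho] below the left side, every intensity of the
    prior would lie farther than [rho] from the constants and be missed with probability at most
    [beta], against [exists_undetected]. *)
Lemma minimax_separation_rate_ge (delta gamma r r' r'' alpha beta L a : R)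
    (p q : nat) :
  0 < gamma -> 2 <= r'' -> alpha + beta <= 59 / 100 -> 0 < L -> 0 <= a ->
  a * 2 `^ ((p + q)%:R / 2) <= 1 ->
  a ^+ 2 * (2 ^ p)%:R <= r ^+ 2 * 2 `^ (- (2 * (p + q)%:R * delta)) ->
  a ^+ 2 * (2 ^ p)%:R <= r' ^+ 2 * (a ^+ 2) `^ (2 * gamma / (1 + 2 * gamma)) ->
  (2 ^ p)%:R / (2 * (2 ^ q)%:R) * ((L * a ^+ 2) ^+ 2 * expR (L * a ^+ 2)) <= 1 / 8 ->
  ((Num.sqrt (a ^+ 2 * (2 ^ p)%:R))%:E <= minimax_separation_rate (P L) N
    (besov_body delta r `&` weak_besov_body gamma r' `&` bounded_by r'')
    alpha beta)%E.
Proof.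
move=> g0 r2 ab L0 a0 bound besov weak chi2.
set S1 := _ `&` bounded_by r''; set J := (p + q)%N in bound besov weak *.
pose X := {ffun 'I_(2 ^ p) -> 'I_(2 ^ q) * bool}.
pose s (f : X) := bump J a (prior_index f) (prior_sign R f).
pose c := cell (R := R) J.+1; have mc := @measurable_cell R J.+1.
(* The intensity read off at cell representatives. The grid has level [J.+1] because wavelets of
   level [J] are constant on intervals of that length. *)
pose v f (o : option 'I_(2 ^ J.+1)) := s f (cell_point R o).
have KJ f b := prior_index_lt f b : (prior_index f b < 2 ^ J)%N.
have Kinj f := @prior_index_inj p q f.
have sg2 f b := @prior_sign_sqr R p q f b.
have vc f : v f \o c = s f.
  by apply/funext => x; rewrite /v /s /bump /= -wave_cell_point.
have v0 f o : 0 <= v f o by exact: bump_ge0.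
have S1s f : S1 (s f) by exact: bump_in_classes.
apply: le_ereal_inf_tmp => _ [Phi [testPhi levelPhi] <-].
apply: le_ereal_inf_tmp => _ [rho [rho0 detect] <-].
rewrite leNgt; apply/negP; rewrite lte_fin => rho_small.
have hPv (w : option 'I_(2 ^ J.+1) -> R) : (forall o, 0 <= w o) ->
    poisson_process (P L (w \o c)) N (mean_measure L (w \o c)).
  move=> w0; apply: hP => //; apply: bounded_mfun_intensity => [|x]; last exact: w0.
  exact: bounded_mfun_step.
have overlap f g : \sum_o cell_weight (c @^-1` [set o]) * ((v f o - 1) * (v g o - 1))
    = a ^+ 2 * \sum_b prior_sign R f b * prior_sign R g b * ((f b).1 == (g b).1)%:R.
  rewrite -prior_overlap -(inner01_wave a _ _ (KJ f) (KJ g)).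
  rewrite /cell_weight -(Rintegral_step mc); apply: eq_Rintegral => x _.
  rewrite -[v f _]/((v f \o c) x) -[v g _]/((v g \o c) x) !vc /s /bump.
  by congr (_ * _); rewrite addrC addKr.
have X0 : (0 < #|{: X}|)%N.
  by apply/card_gt0P; exists [ffun=> (Ordinal (expn_gt0 2 q), true)].
have cardX : #|{: X}|%:R = (2 ^ q).*2%:R ^+ (2 ^ p) :> R.
  by rewrite card_ffun card_prod card_bool !card_ord muln2 natrX.
have [||f] := @exists_undetected _ _ _ N L _ c mc (fun w => P L (w \o c)) L0 hPv
  X v [set m | Phi m] alpha beta X0 v0 testPhi _ ab.
(* The inner sum over [g] does not depend on [f], so the double sum is the cardinal of [X] times one
   value. *)
- under eq_bigr => f _.
    under eq_bigr => g _ do rewrite overlap (mulrA L (a ^+ 2)).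
    rewrite prior_chi2; over.
  rewrite sumr_const -[X in X <= _]mulr_natl cardX.
  have := prior_chi2_le (mulr_ge0 (ltW L0) (sqr_ge0 a)) chi2.
  set D := _.*2%:R ^+ (2 ^ p) => le.
  have -> : 29 / 25 * D ^+ 2 = D * (29 / 25 * D) by ring.
  by rewrite ler_wpM2l// exprn_ge0.
- apply: levelPhi; first by exists 1.
  by apply: bounded_mfun_intensity => [|x] //; exact: bounded_mfun_cst.
apply/negP; rewrite -leNgt; apply: le_trans detect; apply: ereal_sup_ubound.
exists (s f); last by rewrite vc; congr (P L _ _); apply/seteqP; split => w /= /negP.
split; first exact: S1s.
by apply: lt_le_trans (dist01_bump _ _ _ _); rewrite ?lte_fin.
Qed.

End minimax.

(** * Lower limits and logarithm estimates *)

Lemma limf_einf_pinfty_gt0 (R : realType) (f : R -> \bar R) (c M : R) :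
  0 < c -> (forall x, M < x -> (c%:E <= f x)%E) ->
  (0 < limf_einf f (pinfty_nbhs R))%E.
Proof.
move=> c0 fc; rewrite limf_einfE; apply: (@lt_le_trans _ _ c%:E); first by rewrite lte_fin.
apply: le_trans (ereal_sup_ubound _); last first.
  by exists [set x | M < x] => //; exists M; split; [exact: num_real|].
by apply: le_ereal_inf_tmp => _ [x Mx <-]; exact: fc.
Qed.

Lemma powR_expR (R : realType) (x y : R) : 0 < x -> x `^ y = expR (y * ln x).
Proof. by move=> x0; rewrite /powR gt_eqF. Qed.

Lemma exists_natr_floor (R : realType) (y : R) : 0 <= y ->
  exists n : nat, n%:R <= y < n%:R + 1.
Proof. by move=> y0; exists (Num.truncn y); rewrite natr1; exact: truncn_itv. Qed.

Lemma ln2_ge (R : realType) : 1 / 2 <= ln (2 : R).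
Proof.
have := expR_ge1Dx (- ln (2 : R)); rewrite expRN lnK ?posrE//; lra.
Qed.

Lemma ln_le_subr1 (R : realType) (y : R) : 0 < y -> ln y <= y - 1.
Proof.
move=> y0; have := @le_ln1Dx R (y - 1); have -> : 1 + (y - 1) = y by ring.
by apply; lra.
Qed.

(** Used with [y = ln L] and a small slope [e], so that [ln (ln L)] is absorbed by a small multiple
    of [ln L]. *)
Lemma ln_le_linear (R : realType) (e y : R) : 0 < e -> 0 < y ->
  ln y <= e * y - 1 - ln e.
Proof.
move=> e0 y0; have := ln_le_subr1 (mulr_gt0 e0 y0); rewrite lnM ?posrE//; lra.
Qed.

Lemma expR_N2ln2 (R : realType) : expR (- (2 * ln 2)) = 4^-1 :> R.
Proof. by rewrite expRN expRM_natl lnK ?posrE// -natrX. Qed.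

(** * The three rates *)

Section rates.
Context (R : realType) (d : measure_display) (Omega : measurableType d)
  (N : R.-ker Omega ~> measurableTypeR R)
  (P : R -> (R -> R) -> probability Omega R)
  (hP : forall (L : R) (s : R -> R), 0 < L -> intensity s ->
            poisson_process (P L s) N (mean_measure L s))
  (delta gamma r r' r'' alpha beta : R)
  (hdelta : 0 < delta) (hgamma : 0 < gamma) (hr : 0 < r) (hr' : 0 < r')
  (hr'' : 2 <= r'') (hab : alpha + beta <= 59 / 100).

Local Notation rate L := (minimax_separation_rate (P L) N
  (besov_body delta r `&` weak_besov_body gamma r' `&` bounded_by r'') alpha beta).
Local Notation ln2 := (ln 2 : R).

(* With a ^ 2 = expR x and L = expR l the conditions on the prior become
   linear in x, l, p ln 2 and q ln 2, up to one exponential. *)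
Lemma rate_ge_expR (l x : R) (p q : nat) :
  x + (p + q)%:R * ln2 <= 0 ->
  x + p%:R * ln2 <= 2 * ln r - 2 * delta * ((p + q)%:R * ln2) ->
  x + (1 + 2 * gamma) * (p%:R * ln2) <= 2 * (1 + 2 * gamma) * ln r' ->
  (p%:R - q%:R) * ln2 + 2 * (l + x) + expR (l + x) <= - 2 * ln2 ->
  ((expR ((x + p%:R * ln2) / 2))%:E <= rate (expR l))%E.
Proof.
move=> H1 H2 H3 H4.
have pow2 n : (2 ^ n)%:R = expR (n%:R * ln2) :> R.
  by rewrite natrX -powR_mulrn// powR_expR.
have sqrE (y : R) : 0 < y -> y ^+ 2 = expR (2 * ln y).
  by move=> y0; rewrite -powR_mulrn ?ltW// powR_expR.
have aE : expR (x / 2) ^+ 2 = expR x.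
  by rewrite -expRM_natl; congr expR; field.
have -> : expR ((x + p%:R * ln2) / 2) = Num.sqrt (expR (x / 2) ^+ 2 * (2 ^ p)%:R).
  rewrite aE pow2 -expRD.
  have -> : expR (x + p%:R * ln2) = expR ((x + p%:R * ln2) / 2) ^+ 2.
    by rewrite -expRM_natl; congr expR; field.
  by rewrite sqrtr_sqr ger0_norm// expR_ge0.
have g1 : 0 < 1 + 2 * gamma by rewrite addr_gt0 ?mulr_gt0.
apply: (@minimax_separation_rate_ge _ _ _ _ _ hP _ _ _ _ _ _ _ _ _ p q) => //.
- exact: expR_gt0.
- rewrite powR_expR// -expRD -[leRHS]expR0 ler_expR; lra.
- rewrite aE pow2 powR_expR// sqrE// -!expRD ler_expR; lra.
- rewrite aE pow2 powR_expR ?expR_gt0// expRK sqrE// -!expRD ler_expR.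
  rewrite -(ler_pM2l g1).
  have -> : (1 + 2 * gamma) * (2 * ln r' + 2 * gamma / (1 + 2 * gamma) * x)
    = 2 * (1 + 2 * gamma) * ln r' + 2 * gamma * x by field; rewrite gt_eqF.
  lra.
- rewrite aE -expRD !pow2 -expRM_natl.
  have -> : expR (p%:R * ln2) / (2 * expR (q%:R * ln2)) *
      (expR (2 * (l + x)) * expR (expR (l + x)))
      = 2^-1 * expR ((p%:R - q%:R) * ln2 + 2 * (l + x) + expR (l + x)).
    rewrite invfM -expRN !expRD mulrBl expRD; ring.
  have : expR ((p%:R - q%:R) * ln2 + 2 * (l + x) + expR (l + x)) <= expR (- 2 * ln2).
    by rewrite ler_expR.
  (* The right side is 1/4, and the factor 1/2 brings it to the required 1/8. *)
  by rewrite mulNr expR_N2ln2; lra.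
Qed.

Lemma rate_parametric :
  (0 < limf_einf (fun L : R => (L `^ (1 / 2))%:E * rate L) (pinfty_nbhs R))%E.
Proof.
have l2 := ln2_ge R.
pose l0 := Num.max 0 (Num.max (- (2 * ln r)) (- (2 * (1 + 2 * gamma) * ln r'))).
apply: (@limf_einf_pinfty_gt0 _ _ (expR (- ln2)) (expR l0)); first exact: expR_gt0.
move=> L Ll; have L0 : 0 < L by rewrite (lt_trans _ Ll) ?expR_gt0.
have : l0 < ln L by rewrite -ltr_expR lnK.
rewrite /l0 !gt_max => /andP[k0 /andP[k1 k2]].
have LE : L = expR (ln L) by rewrite lnK.
rewrite powR_expR// {2}LE; set l := ln L in k0 k1 k2 *.
have := @rate_ge_expR l (- l - 2 * ln2) 0 0.
rewrite addn0 !mulr0n !mul0r !mulr0 !addr0 !subr0 mul0r add0r => H.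
apply: (@le_trans _ _ ((expR (1 / 2 * l))%:E * (expR ((- l - 2 * ln2) / 2))%:E)%E).
  by rewrite -EFinM -expRD lee_fin ler_expR; lra.
rewrite lee_pmul2l// ?lte_fin ?expR_gt0//; apply: H; [lra|lra|lra|].
have -> : l + (- l - 2 * ln2) = - (2 * ln2) by ring.
rewrite expR_N2ln2; lra.
Qed.


(* 2 ^ J = L ^ (2 / (1 + 4 delta)) and 2 ^ p = 2 ^ (theta J), up to factors 2,
   with theta = min(1, delta / gamma); theta = 1 is the dense prior, and when
   delta < gamma the weak Besov condition forces sparsity. *)
Lemma rate_besov : Num.max (gamma / 2) (gamma / (1 + 2 * gamma)) <= delta ->
  (0 < limf_einf (fun L : R => (L `^ (2 * delta / (1 + 4 * delta)))%:E * rate L)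
    (pinfty_nbhs R))%E.
Proof.
have d0 := hdelta; have g0 := hgamma.
rewrite ge_max => /andP[hd1 hd2].
have l2 := ln2_ge R; have l20 : 0 < ln2 by lra.
have g1 : 0 < 1 + 2 * gamma by rewrite addr_gt0 ?mulr_gt0.
have d1 : 0 < 1 + 4 * delta by rewrite addr_gt0 ?mulr_gt0.
pose theta := Num.min 1 (delta / gamma).
have dg : delta / gamma * gamma = delta by rewrite divfK ?gt_eqF.
have th1 : theta <= 1 by rewrite ge_min lexx.
have thg : theta * gamma <= delta.
  by rewrite -[leRHS]dg ler_pM2r// ge_min lexx orbT.
(* From [gamma / 2 <= delta]; this later keeps [u = L * a ^+ 2] at most 1. *)
have th2 : 1 / 2 <= theta.
  rewrite le_min; apply/andP; split; first lra.
  by rewrite ler_pdivlMr//; lra.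
have th3 : 1 - 2 * delta <= theta.
  rewrite le_min; apply/andP; split; first lra.
  rewrite ler_pdivlMr//; move: hd2; rewrite ler_pdivrMr//; lra.
(* The logarithm of a constant factor in [a ^+ 2], small enough to absorb rounding and the radii [r]
   and [r']. *)
pose kappa := Num.min (- (2 * ln2)) (Num.min (2 * ln r) (2 * (1 + 2 * gamma) * ln r')).
have k0 : kappa <= - (2 * ln2) by rewrite ge_min lexx.
have k1 : kappa <= 2 * ln r by rewrite !ge_min lexx orbT.
have k2 : kappa <= 2 * (1 + 2 * gamma) * ln r' by rewrite !ge_min lexx !orbT.
apply: (@limf_einf_pinfty_gt0 _ _ (expR (kappa / 2 - delta * ln2)) 1).
  exact: expR_gt0.
move=> L L1; have L0 : 0 < L by lra.
have l0 : 0 < ln L by rewrite ln_gt0.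
have LE : L = expR (ln L) by rewrite lnK.
rewrite powR_expR// {2}LE; set l := ln L in l0 *.
pose y := 2 * l / (1 + 4 * delta).
have yE : y * (1 + 4 * delta) = 2 * l by rewrite /y divfK ?gt_eqF.
have y0 : 0 < y by rewrite divr_gt0 ?mulr_gt0.
(* [J] is rounded up, as the second moment condition needs [y <= J * ln2]; this costs the rate a
   constant factor only. Below, [p] is rounded down to respect the weak Besov condition. *)
have [J0 /andP[J1 J2]] := exists_natr_floor (ltW (divr_gt0 y0 l20)).
pose J := J0.+1; have JE : J%:R = J0%:R + 1 :> R by rewrite -natr1.
have {J1}Jy : J%:R * ln2 <= y + ln2.
  by rewrite JE mulrDl mul1r lerD2r -ler_pdivlMr.
have {J2}yJ : y <= J%:R * ln2 by rewrite -ler_pdivrMr// JE ltW.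
have th0 : 0 <= theta by lra.
have [p /andP[p1 p2]] := exists_natr_floor (mulr_ge0 th0 (ler0n R J)).
have pJ : (p <= J)%N.
  rewrite -(ler_nat R) (le_trans p1)// ler_piMl//.
pose q := (J - p)%N; have qE : q%:R = J%:R - p%:R :> R by rewrite natrB.
have pq : (p + q)%N = J by rewrite subnKC.
pose j := J%:R * ln2; pose i := p%:R * ln2.
have i1 : i <= theta * j by rewrite /i /j mulrA ler_pM2r.
have i2 : theta * j <= i + ln2.
  by rewrite /i /j mulrA -[X in _ + X]mul1r -mulrDl ler_pM2r// ltW.
have j0 : 0 <= j by rewrite mulr_ge0// ltW.
have thj3 : (1 - 2 * delta) * j <= theta * j by rewrite ler_wpM2r.
have thj2 : 1 / 2 * j <= theta * j by rewrite ler_wpM2r.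
have gi : gamma * i <= delta * j.
  apply: (@le_trans _ _ (theta * gamma * j)); last by rewrite ler_wpM2r.
  by rewrite mulrAC mulrC ler_pM2r.
have dJy : delta * j <= delta * (y + ln2) by rewrite ler_pM2l.
have yJd : y * (1 + 4 * delta) <= j * (1 + 4 * delta) by rewrite ler_pM2r.
have := @rate_ge_expR l (kappa - 2 * delta * j - i) p q.
rewrite pq -/j -/i qE mulrBl mulrBl -/j -/i => H.
have -> : 2 * delta / (1 + 4 * delta) * l = delta * y.
  by rewrite /y; field; rewrite gt_eqF.
apply: (@le_trans _ _ ((expR (delta * y))%:E *
    (expR ((kappa - 2 * delta * j - i + i) / 2))%:E)%E).
  by rewrite -EFinM -expRD lee_fin ler_expR; lra.
rewrite lee_pmul2l// ?lte_fin ?expR_gt0//; apply: H; [lra|lra|lra|].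
have z1 : expR (l + (kappa - 2 * delta * j - i)) <= 1.
  by rewrite -[leRHS]expR0 ler_expR; lra.
lra.
Qed.

(* With M = L / ln L, a ^ 2 is of order 1 / M, 2 ^ p = M ^ (1 / (1 + 2 gamma)) and
   2 ^ J = M ^ k, up to factors 2. Taking k > 2 / (1 + 2 gamma) makes the prior
   so sparse that expR u, a small power of L, is affordable. *)
Lemma rate_weak_besov : Num.max (2 * delta) (1 / 2) < gamma ->
  (0 < limf_einf (fun L : R => ((L / ln L) `^ (gamma / (1 + 2 * gamma)))%:E * rate L)
    (pinfty_nbhs R))%E.
Proof.
have d0 := hdelta; have g0 := hgamma.
rewrite gt_max => /andP[hg1 hg2].
have l2 := ln2_ge R; have l20 : 0 < ln2 by lra.
have g1 : 0 < 1 + 2 * gamma by lra.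
have [g gE] : exists x : R, x = (1 + 2 * gamma)^-1 by exists (1 + 2 * gamma)^-1.
have gg0 : 0 < g by rewrite gE invr_gt0.
have g1E : g * (1 + 2 * gamma) = 1 by rewrite gE mulVf ?gt_eqF.
(* The level exponent [k] must exceed [2 * g] for sparsity, stay at most 1 for the sup norm, and
   satisfy [k * delta <= gamma * g] for the Besov condition. The window is nonempty since
   [1 / 2 < gamma] and [2 * delta < gamma]; [k] is its midpoint and [eta] the sparsity margin. *)
pose kmax := Num.min 1 (gamma * g / delta).
have kmax_gt : 2 * g < kmax.
  rewrite lt_min; apply/andP; split; first by nra.
  by rewrite ltr_pdivlMr// mulrAC ltr_pM2r.
have [k kE] : exists x : R, x = (2 * g + kmax) / 2 by exists ((2 * g + kmax) / 2).
have [eta etaE] : exists x : R, x = k - 2 * g by exists (k - 2 * g).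
have k1 : k <= 1.
  have : kmax <= 1 by rewrite ge_min lexx.
  by rewrite kE; lra.
have kd : k * delta <= gamma * g.
  rewrite -ler_pdivlMr//.
  have : kmax <= gamma * g / delta by rewrite ge_min lexx orbT.
  by rewrite kE; lra.
have k0 : 0 <= k by rewrite kE; lra.
have gk : g <= k by rewrite kE; lra.
have eta0 : 0 < eta by rewrite etaE kE; lra.
pose kappa := Num.min (ln (eta / 4))
  (Num.min 0 (Num.min (2 * ln r) (2 * (1 + 2 * gamma) * ln r'))).
have kp0 : kappa <= ln (eta / 4) by rewrite ge_min lexx.
have kp1 : kappa <= 0 by rewrite !ge_min lexx !orbT.
have kp2 : kappa <= 2 * ln r by rewrite !ge_min lexx !orbT.
have kp3 : kappa <= 2 * (1 + 2 * gamma) * ln r' by rewrite !ge_min lexx !orbT.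
clearbody kappa.
have eta40 : 0 < eta / 4 by lra.
have c0 : expR kappa <= eta / 4.
  by rewrite -[leRHS](lnK (x := eta / 4)) ?posrE// ler_expR.
(* This slope bounds [(eta + 2) * ln l] by [eta / 4 * l] plus a constant; [C] collects the
   constants, and [l0] forces [C <= eta / 2 * l]. *)
have [e eE] : exists x : R, x = eta / 4 / (eta + 2) by exists (eta / 4 / (eta + 2)).
have e0 : 0 < e by rewrite eE divr_gt0//; lra.
have {}eE : e * (eta + 2) = eta / 4 by rewrite eE divfK// gt_eqF//; lra.
have [C CE] : exists x : R, x = 3 * ln2 + (eta + 2) * (- 1 - ln e) by eexists.
pose l0 := Num.max 1 (2 * C / eta).
apply: (@limf_einf_pinfty_gt0 _ _ (expR ((kappa - ln2) / 2)) (expR l0)).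
  exact: expR_gt0.
move=> L Ll; have L0 : 0 < L by rewrite (lt_trans _ Ll) ?expR_gt0.
have : l0 < ln L by rewrite -ltr_expR lnK.
rewrite /l0 gt_max ltr_pdivrMr// => /andP[l1 lC].
have LE : L = expR (ln L) by rewrite lnK.
have lp : 0 < ln L by lra.
rewrite powR_expR ?divr_gt0// ln_div ?posrE// {3}LE.
set l := ln L in l1 lC lp *.
have [mu muE] : exists x : R, x = l - ln l by eexists.
have lnl := ln_le_linear e0 lp.
have mu0 : 0 <= mu by have := ln_le_subr1 lp; rewrite muE; lra.
have [p /andP[p1 p2]] : exists n : nat, n%:R <= g * mu / ln2 < n%:R + 1.
  by apply: exists_natr_floor; rewrite divr_ge0// ?mulr_ge0// ltW.
have [J /andP[J1 J2]] : exists n : nat, n%:R <= k * mu / ln2 < n%:R + 1.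
  by apply: exists_natr_floor; rewrite divr_ge0 ?mulr_ge0// ltW.
have pJ : (p <= J)%N.
  rewrite -ltnS -(ltr_nat R) -natr1 (le_lt_trans p1)// (le_lt_trans _ J2)//.
  by rewrite ler_pM2r ?invr_gt0// ler_wpM2r.
pose q := (J - p)%N; have qE : q%:R = J%:R - p%:R :> R by rewrite natrB.
have pq : (p + q)%N = J by rewrite subnKC.
have [j jE] : exists x : R, x = J%:R * ln2 by eexists.
have [i iE] : exists x : R, x = p%:R * ln2 by eexists.
have i1 : i <= g * mu by rewrite iE -ler_pdivlMr.
have i2 : g * mu <= i + ln2.
  by rewrite iE -[X in _ + X]mul1r -mulrDl -ler_pdivrMr// ltW.
have j1 : j <= k * mu by rewrite jE -ler_pdivlMr.
have j2 : k * mu <= j + ln2.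
  by rewrite jE -[X in _ + X]mul1r -mulrDl -ler_pdivrMr// ltW.
have kmu : k * mu <= mu by rewrite ler_piMl.
have kdmu : k * delta * mu <= gamma * g * mu by rewrite ler_wpM2r.
have dj : delta * j <= delta * (k * mu) by rewrite ler_pM2l.
have gmu : (1 + 2 * gamma) * (g * mu) = mu by rewrite mulrA [_ * g]mulrC g1E mul1r.
have gi : (1 + 2 * gamma) * i <= mu by rewrite -gmu ler_pM2l.
(* Here [mu] is the logarithm of [L / ln L], so [a ^+ 2] is [expR kappa * ln L / L]. *)
have := @rate_ge_expR l (kappa - mu) p q.
rewrite pq qE mulrBl -jE -iE => H.
apply: (@le_trans _ _ ((expR (gamma * g * mu))%:E *
    (expR ((kappa - mu + i) / 2))%:E)%E).
  by rewrite -EFinM -expRD lee_fin ler_expR; lra.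
rewrite -gE -muE lee_pmul2l// ?lte_fin ?expR_gt0//; apply: H; [lra|lra|lra|].
have z1 : expR (l + (kappa - mu)) <= eta / 4 * l.
  have -> : l + (kappa - mu) = kappa + ln l by rewrite muE; ring.
  by rewrite expRD lnK ?posrE// ler_pM2r.
have lnl2 : (eta + 2) * ln l <= eta / 4 * l + (eta + 2) * (- 1 - ln e).
  rewrite -eE (mulrC e) -mulrA -mulrDr addrA.
  by rewrite ler_pM2l ?(le_trans lnl)//; lra.
have etamu : eta * mu = k * mu - 2 * (g * mu) by rewrite etaE; ring.
(* The sparsity gain [- eta * l] pays [eta / 4 * l] for [u] and [eta / 4 * l] for the [ln l] terms;
   the remaining [- eta / 2 * l] beats [C]. *)
move: lC; rewrite CE; move: etamu; rewrite {1}muE; lra.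
Qed.

End rates.

Theorem theorem1 (R : realType)
    (d : measure_display) (Omega : measurableType d)
    (N : R.-ker Omega ~> measurableTypeR R)
    (P : R -> (R -> R) -> probability Omega R)
    (hP : forall (L : R) (s : R -> R), 0 < L -> intensity s ->
            poisson_process (P L s) N (mean_measure L s))
    (delta gamma r r' r'' alpha beta : R)
    (hdelta : 0 < delta) (hgamma : 0 < gamma)
    (hr : 0 < r) (hr' : 0 < r') (hr'' : 2 <= r'')
    (halpha : 0 < alpha < 1) (hbeta : 0 < beta < 1)
    (hab : alpha + beta <= 59 / 100) :
  let S1 := besov_body delta r `&` weak_besov_body gamma r' `&` bounded_by r'' in
  let rate := fun L : R => minimax_separation_rate (P L) N S1 alpha beta in
  [/\ Num.max (2 * delta) (1 / 2) < gamma ->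
        (0 < limf_einf (fun L : R =>
               ((L / ln L) `^ (gamma / (1 + 2 * gamma)))%:E * rate L)
             (pinfty_nbhs R))%E,
      Num.max (gamma / 2) (gamma / (1 + 2 * gamma)) <= delta ->
        (0 < limf_einf (fun L : R =>
               (L `^ (2 * delta / (1 + 4 * delta)))%:E * rate L)
             (pinfty_nbhs R))%E &
      delta < gamma / (1 + 2 * gamma) -> gamma <= 1 / 2 ->
        (0 < limf_einf (fun L : R => (L `^ (1 / 2))%:E * rate L)
             (pinfty_nbhs R))%E].
Proof.
by split=> *; [exact: rate_weak_besov|exact: rate_besov|exact: rate_parametric].
Qed.
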